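(* For a finite automaton $A$ over $\Sigma=\Sigma_l\uplus\Sigma_h$ such that $A\backslash\Sigma_h$ is non-deterministic, the SNNI controller synthesis problem (given $A$ and a set $\Sigma_c\subseteq\Sigma$ of controllable actions, decide whether there exists a controller $C$ such that $C(A)$ is SNNI and, if so, compute one) can be solved in EXPTIME.
   Context: A finite automaton is $A=(Q,q_0,\Sigma^\varepsilon,E)$ with finite states $Q$, initial $q_0$, finite alphabet $\Sigma$, $\Sigma^\varepsilon=\Sigma\cup\{\varepsilon\}$, edges $E\subseteq Q\times\Sigma^\varepsilon\times Q$; it is deterministic if any two edges with the same source and the same label have the same target. Its language $\mathcal{L}(A)\subseteq\Sigma^*$ is the set of labels ($\varepsilon$ erased) of finite paths from $q_0$ (time is not taken into account). For $L\subseteq\Sigma$, $A/L$ relabels by $\varepsilon$ every edge labelled in $L$, and $A\backslash L$ deletes those edges. A system is SNNI iff $\mathcal{L}(\cdot\backslash\Sigma_h)=\mathcal{L}(\cdot/\Sigma_h)$. Let $\Sigma_u=\Sigma\setminus\Sigma_c$. A controller maps each run $\rho$ of $A$ to a subset $C(\rho)\subseteq\Sigma_c$ (possibly empty); $C(A)$ is the system whose runs are defined inductively: the empty run is a run, and an extension $\rho\xrightarrow{e}q'$ (a run of $A$) of a run $\rho$ of $C(A)$ is a run of $C(A)$ iff $e\in\Sigma_u$ or $e\in\Sigma_c\cap C(\rho)$. *)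

(* Defs.v *)
From HB Require Import structures.
From mathcomp Require Import all_boot all_order all_algebra.

Set Implicit Arguments.
Unset Strict Implicit.
Unset Printing Implicit Defensive.

(* Possibly infinite, since a controlled automaton is a system whose states are
   runs. The label [None] is the silent action epsilon. *)
Record system (S : finType) := System {
  sys_state : Type;
  sys_init : sys_state;
  sys_trans : sys_state -> option S -> sys_state -> Prop
}.

Section Systems.
Variable S : finType.
Implicit Types (Y : system S) (L : {set S}).

(* A run q0 -e1-> q1 ... -ek-> qk is the sequence (e1, q1), ..., (ek, qk). *)
Fixpoint run_from Y (q : sys_state Y) (r : seq (option S * sys_state Y)) : Prop :=
  if r is (e, q') :: r' then sys_trans q e q' /\ run_from q' r' else True.

Definition is_run Y (r : seq (option S * sys_state Y)) : Prop :=
  run_from (sys_init Y) r.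

Definition trace (T : Type) (r : seq (option S * T)) : seq S :=
  pmap (fun st => st.1) r.

Definition language Y (w : seq S) : Prop :=
  exists r : seq (option S * sys_state Y), is_run r /\ trace r = w.

Definition deterministic Y : Prop :=
  forall (q : sys_state Y) e q1 q2,
    sys_trans q e q1 -> sys_trans q e q2 -> q1 = q2.

Definition label_in L (e : option S) : bool :=
  if e is Some a then a \in L else false.

(* Y / L *)
Definition hide Y L : system S :=
  @System S (sys_state Y) (sys_init Y) (fun q e q' =>
    exists e', sys_trans q e' q' /\ e = (if label_in L e' then None else e')).

(* Y \ L *)
Definition restrict Y L : system S :=
  @System S (sys_state Y) (sys_init Y) (fun q e q' =>
    sys_trans q e q' /\ ~~ label_in L e).

Definition SNNI Y (Sh : {set S}) : Prop :=
  forall w, language (restrict Y Sh) w <-> language (hide Y Sh) w.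

End Systems.

Record automaton (Q S : finType) := Automaton {
  aut_init : Q;
  aut_edges : {set Q * option S * Q}
}.

Definition aut_system (Q S : finType) (A : automaton Q S) : system S :=
  @System S Q (aut_init A) (fun q e q' => (q, e, q') \in aut_edges A).

Coercion aut_system : automaton >-> system.

Section Control.
Variables (Q S : finType) (A : automaton Q S) (Sc : {set S}).

(* Only the values on runs of A matter. *)
Definition controller (C : seq (option S * Q) -> {set S}) : Prop :=
  forall r : seq (option S * Q), @is_run S A r -> C r \subset Sc.

(* Epsilon is not in Sc, hence not controllable: it is never disabled. *)
Definition enabled (e : option S) (U : {set S}) : bool :=
  if e is Some a then (a \notin Sc) || (a \in Sc :&: U) else true.

(* C(A): the states reachable from the empty run are the runs of C(A). *)
Definition controlled (C : seq (option S * Q) -> {set S}) : system S :=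
  @System S (seq (option S * Q)) [::] (fun r e r' =>
    exists q', [/\ r' = rcons r (e, q'), @is_run S A r' & enabled e (C r)]).

Definition SNNI_controller (Sh : {set S}) C : Prop :=
  controller C /\ SNNI (controlled C) Sh.

End Control.

(* Finite-memory controllers: the memory is updated along the run, and the set
   of allowed controllable actions is read off the memory. *)
Record fsc (Q S : finType) := FSC {
  fsc_size : nat;
  fsc_init : 'I_fsc_size;
  fsc_next : 'I_fsc_size -> option S * Q -> 'I_fsc_size;
  fsc_out : 'I_fsc_size -> {set S}
}.

Definition fsc_controller (Q S : finType) (F : fsc Q S)
    (r : seq (option S * Q)) : {set S} :=
  fsc_out (foldl (@fsc_next Q S F) (fsc_init F) r).

Inductive move := Left | Stay | Right.

(* Deterministic multi-tape machine. Tapes are indexed by a finite type with a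
   distinguished input/output tape; a cell is blank ([None]), a bit, or an
   auxiliary symbol; the machine halts where [tm_delta] is [None]. *)
Record TM := MkTM {
  tm_state : finType;
  tm_tape : finType;
  tm_aux : finType;
  tm_start : tm_state;
  tm_io : tm_tape;
  tm_delta : tm_state -> {ffun tm_tape -> option (bool + tm_aux)} ->
    option (tm_state * {ffun tm_tape -> option (bool + tm_aux) * move})
}.

Section TuringMachines.
Variable M : TM.

Definition cell : Type := option (bool + tm_aux M).

(* (l, r): l lists the cells left of the head, nearest first; r lists the cells
   from the head on; all the other cells are blank. *)
Definition tape : Type := (seq cell * seq cell)%type.

Definition tape_read (t : tape) : cell := head None t.2.

Definition tape_act (t : tape) (a : cell * move) : tape :=
  let r := a.1 :: behead t.2 in
  match a.2 with
  | Left => (behead t.1, head None t.1 :: r)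
  | Stay => (t.1, r)
  | Right => (a.1 :: t.1, behead t.2)
  end.

Definition config : Type := (tm_state M * {ffun tm_tape M -> tape})%type.

Definition tm_action (c : config) :=
  @tm_delta M c.1 [ffun i => tape_read (c.2 i)].

Definition tm_step (c : config) : config :=
  if tm_action c is Some (s, a) then (s, [ffun i => tape_act (c.2 i) (a i)])
  else c.

Definition tm_halted (c : config) : bool := ~~ tm_action c.

Definition tm_input (x : bitseq) : config :=
  (tm_start M,
   [ffun i => if i == tm_io M then ([::], [seq Some (inl b) | b <- x])
              else ([::], [::])]).

Fixpoint leading_bits (s : seq cell) : bitseq :=
  if s is Some (inl b) :: s' then b :: leading_bits s' else [::].

(* The output is the longest bit string starting at the head of the i/o tape. *)
Definition tm_output (c : config) : bitseq := leading_bits (c.2 (tm_io M)).2.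

(* [tm_step] fixes halted configurations, so this says "at most n steps". *)
Definition tm_computes_within (n : nat) (x y : bitseq) : Prop :=
  let c := iter n tm_step (tm_input x) in tm_halted c /\ tm_output c = y.

End TuringMachines.

(* Search problem on the instances satisfying [promise], where [answer x y]
   means that the bit string y is a correct answer to x. *)
Definition solvable_in_EXPTIME (X : Type) (enc : X -> bitseq)
    (promise : X -> Prop) (answer : X -> bitseq -> Prop) : Prop :=
  exists (M : TM) (p : {poly nat}), forall x : X, promise x ->
    exists y : bitseq,
      tm_computes_within M (2 ^ (p.[size (enc x)])%R) (enc x) y /\ answer x y.

(* An instance of a computational problem: states and actions are numbered, and
   the low actions are those not in [inst_high]. *)
Record instance := Instance {
  inst_nstates : nat;
  inst_nactions : nat;
  inst_aut : automaton 'I_inst_nstates 'I_inst_nactions;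
  inst_high : {set 'I_inst_nactions};
  inst_ctrl : {set 'I_inst_nactions}
}.

Definition enc_nat (n : nat) : bitseq := rcons (nseq n true) false.

Definition enc_set (T : finType) (B : {set T}) : bitseq :=
  [seq x \in B | x <- enum T].

Definition enc_instance (I : instance) : bitseq :=
  enc_nat (inst_nstates I) ++ enc_nat (inst_nactions I)
  ++ enc_set [set aut_init (inst_aut I)]
  ++ enc_set (inst_high I) ++ enc_set (inst_ctrl I)
  ++ enc_set (aut_edges (inst_aut I)).

Definition enc_fsc (Q S : finType) (F : fsc Q S) : bitseq :=
  enc_nat (fsc_size F) ++ enc_set [set fsc_init F]
  ++ flatten [seq enc_set (fsc_out x) | x <- enum 'I_(fsc_size F)]
  ++ flatten [seq enc_set [set fsc_next x st]
               | x <- enum 'I_(fsc_size F), st <- enum {: option S * Q}].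

(* Either "no", when there is no controller at all (of any kind), or "yes"
   followed by a finite-memory controller enforcing SNNI. *)
Definition SNNI_CSP_answer (I : instance) (y : bitseq) : Prop :=
  (y = [:: false] /\
     ~ exists C, SNNI_controller (inst_aut I) (inst_ctrl I) (inst_high I) C)
  \/
  (exists F : fsc 'I_(inst_nstates I) 'I_(inst_nactions I),
     y = true :: enc_fsc F /\
     SNNI_controller (inst_aut I) (inst_ctrl I) (inst_high I)
       (fsc_controller F)).

(* Main.v *)
From mathcomp Require Import all_boot all_order all_algebra.
From mathcomp Require Import zify.
Require Import Defs.

(** Runs without controllable actions belong to every controlled system, and a low run
    reading the trace of such a run contains no controllable action either. So a
    controller enforcing SNNI exists iff the one that disables every controllable
    action does, and it remains to decide SNNI for the automaton [Au] of uncontrollable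
    edges. SNNI fails iff, in the graph of pairs (state of [Au] / Sh, epsilon-closed set
    of states of [Au] \ Sh), where a step may enlarge the set, some pair with an empty
    second component is reachable; this graph has [n * 2 ^ n] vertices.

    Reachability is tabulated by a program in a small expression language on bit strings
    whose only source of growth saturates at a given length [N]; such a program runs in
    time polynomial in [N] on a multi-stack machine, hence on a Turing machine, and
    [N = 2 ^ size x] is large enough on input [x]. *)

Set Implicit Arguments.
Unset Strict Implicit.
Unset Printing Implicit Defensive.

(** * Stack programs on Turing machines *)

(** The second component of a pair may be enlarged because its only use is to become empty: a larger
    set makes the claim that no low run can follow stronger. A step is then a conjunction of
    inclusions, testable bit by bit, and no successor set or epsilon closure has to be computed by
    the program.

    The cap makes the time analysis compositional. Once no value is longer than [N], a loop runs at
    most [N] times whatever its body does, so the cost is a polynomial in [N] read off the syntax,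
    and its degree may grow freely with the nesting of loops and the repeated evaluation of
    subterms. The same [N] bounds arithmetic, the codes of sets, the table indices and the number of
    rounds. Finally [(N + 2) ^ a] with [N = 2 ^ size x] is at most [2 ^ (a * (size x + 2))], whose
    exponent is a polynomial in the input size. *)

Definition store := nat -> bitseq.

(** Stores are functions, so [exec] compares them pointwise and needs no extensionality axiom. *)
Definition upd (s : store) (i : nat) (v : bitseq) : store :=
  fun j => if j == i then v else s j.

Inductive cmd :=
  | Skip
  | Push of nat & bool
  | Pop of nat
  | Then of cmd & cmd
  | Branch of nat & cmd & cmd & cmd
  | While of nat & cmd.

Definition select (T : Type) (v : bitseq) (x0 x1 x2 : T) : T :=
  if v is b :: _ then (if b then x2 else x1) else x0.

(* The last argument is an upper bound on the number of machine steps. *)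
Inductive exec : cmd -> store -> store -> nat -> Prop :=
  | exec_skip s s' t : s' =1 s -> 0 < t -> exec Skip s s' t
  | exec_push i b s s' t :
      s' =1 upd s i (b :: s i) -> 1 < t -> exec (Push i b) s s' t
  | exec_pop i s s' t :
      s' =1 upd s i (behead (s i)) -> 0 < t -> exec (Pop i) s s' t
  | exec_then c1 c2 s s1 s' t1 t2 t :
      exec c1 s s1 t1 -> exec c2 s1 s' t2 -> t1 + t2 <= t ->
      exec (Then c1 c2) s s' t
  | exec_branch i c0 c1 c2 s s' t1 t :
      exec (select (s i) c0 c1 c2) s s' t1 -> t1 < t ->
      exec (Branch i c0 c1 c2) s s' t
  | exec_while_nil i c s s' t :
      s i = [::] -> s' =1 s -> 0 < t -> exec (While i c) s s' t
  | exec_while_cons i c s s1 s' t1 t2 t :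
      s i != [::] -> exec c s s1 t1 -> exec (While i c) s1 s' t2 ->
      t1 + t2 < t -> exec (While i c) s s' t.

Lemma exec_le c s s' t t' : t <= t' -> exec c s s' t -> exec c s s' t'.
Proof.
move=> le_t E; case: E le_t.
- by move=> *; apply: exec_skip => //; lia.
- by move=> *; apply: exec_push => //; lia.
- by move=> *; apply: exec_pop => //; lia.
- by move=> c1 c2 {}s s1 {}s' t1 t2 {}t *; apply: (@exec_then _ _ _ s1 _ t1 t2) => //; lia.
- by move=> i c0 c1 c2 {}s {}s' t1 {}t *; apply: (@exec_branch _ _ _ _ _ _ t1) => //; lia.
- by move=> *; apply: exec_while_nil => //; lia.
- by move=> i {}c {}s s1 {}s' t1 t2 {}t *; apply: (@exec_while_cons _ _ _ s1 _ t1 t2) => //; lia.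
Qed.

Fixpoint cmd_tapes (c : cmd) : nat :=
  match c with
  | Skip => 0
  | Push i _ | Pop i => i.+1
  | Then c1 c2 => maxn (cmd_tapes c1) (cmd_tapes c2)
  | Branch i c0 c1 c2 =>
      maxn i.+1 (maxn (cmd_tapes c0) (maxn (cmd_tapes c1) (cmd_tapes c2)))
  | While i c => maxn i.+1 (cmd_tapes c)
  end.

Definition sym : Type := option (bool + void).

(** Control points become machine states. A push takes two of them, to move onto the free cell and
    then to write; the extra [None] of [Branch] and [While] is their test. *)
Fixpoint pc (c : cmd) : finType :=
  match c with
  | Skip | Pop _ => unit : finType
  | Push _ _ => bool : finType
  | Then c1 c2 => (pc c1 + pc c2)%type : finType
  | Branch _ c0 c1 c2 => option (pc c0 + (pc c1 + pc c2)) : finType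
  | While _ c => option (pc c) : finType
  end.

Fixpoint pc_start (c : cmd) : pc c :=
  match c with
  | Skip | Pop _ => tt
  | Push _ _ => false
  | Then c1 c2 => inl (pc_start c1)
  | Branch _ _ _ _ => None
  | While _ _ => None
  end.

(* Next control point ([None] on exit), and the action on at most one tape. *)
Fixpoint pc_next (c : cmd) :
    pc c -> (nat -> sym) -> option (pc c) * option (nat * (sym * move)) :=
  match c with
  | Skip => fun _ _ => (None, None)
  | Pop i => fun _ _ => (None, Some (i, (None, Right)))
  | Push i b => fun p rd =>
      if p then (None, Some (i, (Some (inl b), Stay)))
      else (Some true, Some (i, (rd i, Left)))
  | Then c1 c2 => fun p rd =>
      match p with
      | inl p1 => let: (o, a) := pc_next p1 rd in
          (Some (if o is Some p1' then inl p1' else inr (pc_start c2)), a)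
      | inr p2 => let: (o, a) := pc_next p2 rd in (omap inr o, a)
      end
  | Branch i c0 c1 c2 => fun p rd =>
      match p with
      | None => (Some (Some (match rd i with
                             | Some (inl b) =>
                                 inr (if b then inr (pc_start c2)
                                      else inl (pc_start c1))
                             | _ => inl (pc_start c0)
                             end)), None)
      | Some (inl p0) => let: (o, a) := pc_next p0 rd in
          (omap (fun p' => Some (inl p')) o, a)
      | Some (inr (inl p1)) => let: (o, a) := pc_next p1 rd in
          (omap (fun p' => Some (inr (inl p'))) o, a)
      | Some (inr (inr p2)) => let: (o, a) := pc_next p2 rd in
          (omap (fun p' => Some (inr (inr p'))) o, a)
      end
  | While i c => fun p rd =>
      match p with
      | None => (if rd i is Some _ then Some (Some (pc_start c)) else None, None)
      | Some p1 => let: (o, a) := pc_next p1 rd in (Some o, a)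
      end
  end.

(** A machine step writes on every tape, so an idle tape rewrites the symbol under its head. *)
Definition act_on (a : option (nat * (sym * move))) (i : nat) (x : sym) :
    sym * move :=
  if a is Some (j, a') then (if i == j then a' else (x, Stay)) else (x, Stay).

Definition read_ord k (rd : 'I_k -> sym) (i : nat) : sym :=
  if insub i is Some j then rd j else None.

(** There are at least two tapes, so that tape 1 can be the i/o tape and tape 0 can hold the cap.
    State [None] is the halting one. *)
Definition stack_TM (k : nat) (c : cmd) : TM :=
  @MkTM (option (pc c)) 'I_k.+2 void (Some (pc_start c)) (Ordinal (isT : 1 < k.+2))
    (fun o rd =>
       if o is Some p then
         let: (o', a) := pc_next p (read_ord rd) in
         Some (o', [ffun i : 'I_k.+2 => act_on a i (rd i)])
       else None).

Section Simulation.
Variable k : nat.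

Let stape : Type := (seq sym * seq sym)%type.
Let tapes : Type := {ffun 'I_k.+2 -> stape}.
Let act : stape -> sym * move -> stape := @tape_act (stack_TM k Skip).
Let rd : stape -> sym := @tape_read (stack_TM k Skip).

(* The stack is read off from the head rightwards, all other cells are blank. *)
Definition rep_tape (t : stape) (v : bitseq) : Prop :=
  exists a b, t = (nseq a None, [seq Some (inl x) | x <- v] ++ nseq b None).

Definition rep (T : tapes) (s : store) : Prop :=
  forall i : 'I_k.+2, rep_tape (T i) (s i).

Lemma rep_read t v : rep_tape t v -> rd t = if v is b :: _ then Some (inl b) else None.
Proof. by case=> a [b ->]; case: v => [|x v] //=; case: b. Qed.

Lemma rep_stay t v : rep_tape t v -> rep_tape (act t (rd t, Stay)) v.
Proof.
case=> a [b ->]; rewrite /act /tape_act /rd /tape_read /=.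
case: v => [|x v] /=; last by exists a, b.
(* Rewriting the symbol past the end of the list turns an implicit blank into an explicit one, hence
   the trailing blanks in [rep_tape]. *)
by case: b => [|b]; [exists a, 1 | exists a, b.+1].
Qed.

Lemma rep_pop t v : rep_tape t v -> rep_tape (act t (None, Right)) (behead v).
Proof.
case=> a [b ->]; case: v => [|x v] /=; last by exists a.+1, b.
by exists a.+1, b.-1; case: b.
Qed.

Lemma rep_push t v x : rep_tape t v ->
  rep_tape (act (act t (rd t, Left)) (Some (inl x), Stay)) (x :: v).
Proof.
case=> a [b ->]; rewrite /act /tape_act /rd /tape_read /=.
have -> : behead (nseq a (None : sym)) = nseq a.-1 None by case: a.
case: v => [|y v] /=; last by exists a.-1, b.
by exists a.-1, b.-1.+1; case: b.
Qed.

Definition pc_step c (p : pc c) (T : tapes) : option (pc c) * tapes :=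
  let: (o, a) := pc_next p (read_ord [ffun i => rd (T i)]) in
  (o, [ffun i : 'I_k.+2 => act (T i) (act_on a i (rd (T i)))]).

Fixpoint exits c (p : pc c) (T : tapes) (n : nat) (T' : tapes) : Prop :=
  if n is n'.+1 then
    let: (o, T1) := pc_step p T in
    if o is Some p' then exits p' T1 n' T' else n' = 0 /\ T1 = T'
  else False.

Lemma read_ordE T s i : rep T s -> i < k.+2 ->
  read_ord [ffun i => rd (T i)] i = if s i is b :: _ then Some (inl b) else None.
Proof.
move=> rT lti; rewrite /read_ord; case: insubP => [j _ <-|]; last by rewrite lti.
by rewrite ffunE; apply: rep_read.
Qed.

Lemma rep_still T s : rep T s ->
  rep [ffun i : 'I_k.+2 => act (T i) (act_on None i (rd (T i)))] s.
Proof. by move=> rT i; rewrite ffunE; apply: rep_stay. Qed.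

Lemma rep_ext T s s' : s' =1 s -> rep T s -> rep T s'.
Proof. by move=> e rT i; rewrite e. Qed.

Lemma exits_map c c' (f : pc c -> pc c') :
  (forall p rd, pc_next (f p) rd = let: (o, a) := pc_next p rd in (omap f o, a)) ->
  forall n p T T', exits p T n T' -> exits (f p) T n T'.
Proof.
move=> Hf; elim=> //= n IHn p T T'; rewrite /pc_step Hf.
by case: pc_next => -[p'|] a //=; apply: IHn.
Qed.

(** Redirecting the exits to [q] costs no step, so durations add up. Here [q] is the start of the
    next command, or the test of the enclosing loop. *)
Lemma exits_seq c c' (f : pc c -> pc c') (q : pc c') :
  (forall p rd, pc_next (f p) rd =
     let: (o, a) := pc_next p rd in (Some (if o is Some p' then f p' else q), a)) ->
  forall n p T T1 n' T', exits p T n T1 -> exits q T1 n' T' ->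
    exits (f p) T (n + n') T'.
Proof.
move=> Hf; elim=> //= n IHn p T T1 n' T'; rewrite /pc_step Hf.
case: pc_next => -[p'|] a /=; first exact: IHn.
by case=> -> ->.
Qed.

Lemma exec_exits c s s' t : exec c s s' t -> forall T, cmd_tapes c <= k.+2 ->
  rep T s -> exists n T', [/\ n <= t, exits (pc_start c) T n T' & rep T' s'].
Proof.
elim=> {c s s' t}.
- move=> s s' t e t0 T _ rT; exists 1.
  exists [ffun i : 'I_k.+2 => act (T i) (act_on None i (rd (T i)))].
  by split=> //; apply: (rep_ext e); apply: rep_still.
- move=> i b s s' t e t0 T /= lti rT; exists 2; eexists; split=> //=.
  move=> j; rewrite e /upd !ffunE /act_on /=.
  have [eji|nji] := eqVneq (nat_of_ord j) i; last by do 2!apply: rep_stay.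
  have -> : read_ord [ffun i => rd (T i)] i = rd (T j).
    by rewrite (read_ordE rT lti) (rep_read (rT j)) eji.
  by rewrite -eji; apply: rep_push.
- move=> i s s' t e t0 T /= lti rT; exists 1; eexists; split=> //=.
  move=> j; rewrite e /upd !ffunE /act_on /=.
  have [<-|nji] := eqVneq (nat_of_ord j) i; last exact: rep_stay.
  exact: rep_pop.
- move=> c1 c2 s s1 s' t1 t2 t _ IH1 _ IH2 le_t T /=; rewrite geq_max => /andP[k1 k2] rT.
  have [n1 [T1 [le1 E1 R1]]] := IH1 T k1 rT.
  have [n2 [T2 [le2 E2 R2]]] := IH2 T1 k2 R1.
  exists (n1 + n2), T2; split=> //; first lia.
  apply: (@exits_seq c1 (Then c1 c2) (@inl _ _)) E1 _ => //.
  by apply: (@exits_map c2 (Then c1 c2) (@inr _ _)) E2.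
- move=> i c0 c1 c2 s s' t1 t _ IH lt_t T /=; rewrite !geq_max => /and4P[ki k0 k1 k2] rT.
  pose T1 := [ffun j : 'I_k.+2 => act (T j) (act_on None j (rd (T j)))].
  have kc : cmd_tapes (select (s i) c0 c1 c2) <= k.+2 by case: (s i) => [|[]].
  have [n [T' [le_n E R]]] := IH T1 kc (rep_still rT).
  exists n.+1, T'; split=> //; first lia.
  rewrite /= /pc_step /= (read_ordE rT ki); move: E.
  case: (s i) => [|[] l] /=.
  + by apply: (@exits_map c0 (Branch i c0 c1 c2) (fun p => Some (inl p))).
  + by apply: (@exits_map c2 (Branch i c0 c1 c2) (fun p => Some (inr (inr p)))).
  + by apply: (@exits_map c1 (Branch i c0 c1 c2) (fun p => Some (inr (inl p)))).
- move=> i c s s' t si e t0 T /=; rewrite geq_max => /andP[ki kc] rT.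
  exists 1, [ffun j : 'I_k.+2 => act (T j) (act_on None j (rd (T j)))].
  split=> //; last by apply: (rep_ext e); apply: rep_still.
  by rewrite /= /pc_step /= (read_ordE rT ki) si.
- move=> i c s s1 s' t1 t2 t si _ IH1 _ IH2 le_t T /= kk.
  move: (kk); rewrite geq_max => /andP[ki kc] rT.
  have [n1 [T1 [le1 E1 R1]]] := IH1 _ kc (rep_still rT).
  have [n2 [T2 [le2 E2 R2]]] := IH2 T1 kk R1.
  exists (n1 + n2).+1, T2; split=> //; first lia.
  rewrite /= /pc_step /= (read_ordE rT ki).
  case: (s i) si => // b l _ /=.
  apply: (@exits_seq c (While i c) some None) E1 E2 => p r /=.
  by case: pc_next => -[].
Qed.

Lemma exits_TM c n p T T' :
  @exits c p T n T' -> iter n (@tm_step (stack_TM k c)) (Some p, T) = (None, T').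
Proof.
elim: n p T => // n IHn p T; rewrite iterSr /= /pc_step /tm_step /tm_action /=.
case: pc_next => o a E.
rewrite [X in iter n _ (_, X)](_ : _ =
    [ffun i : 'I_k.+2 => act (T i) (act_on a i (rd (T i)))]); last first.
  by apply/ffunP=> i; rewrite !ffunE.
case: o E => [p'|]; first exact: IHn.
by case=> -> ->.
Qed.

End Simulation.

Lemma leading_bits_rep k c v n :
  @leading_bits (stack_TM k c) ([seq Some (inl x) | x <- v] ++ nseq n None) = v.
Proof. by elim: v => [|b v IHv] /=; [case: n | rewrite IHv]. Qed.

Lemma exec_computes c x s t k : cmd_tapes c <= k.+2 ->
  exec c (upd (fun=> [::]) 1 x) s t ->
  forall n, t <= n -> tm_computes_within (stack_TM k c) n x (s 1).
Proof.
move=> kc E n le_tn.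
pose T : {ffun 'I_k.+2 -> _} := (tm_input (stack_TM k c) x).2.
have rT : rep T (upd (fun=> [::]) 1 x).
  move=> i; rewrite ffunE /upd -val_eqE /=.
  by case: eqP => _; [exists 0, 0; rewrite cats0 | exists 0, 0].
have [n1 [T' [le_n1 /exits_TM E1 R1]]] := exec_exits E kc rT.
have -> : n = (n - n1) + n1 by lia.
rewrite /tm_computes_within iterD.
rewrite (_ : iter n1 _ _ = (None, T')) //.
have -> : iter (n - n1) (@tm_step (stack_TM k c)) (None, T') = (None, T').
  by elim: (n - n1) => //= j ->.
split=> //; rewrite /tm_output /=.
by have [a [b /= ->]] := R1 (Ordinal (isT : 1 < k.+2)); apply: leading_bits_rep.
Qed.

(** * Moving, copying and clearing stacks *)

Definition pour (i j : nat) : cmd :=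
  While i (Branch i Skip (Then (Pop i) (Push j false)) (Then (Pop i) (Push j true))).

Definition pour2 (i j k : nat) : cmd :=
  While i (Branch i Skip (Then (Pop i) (Then (Push j false) (Push k false)))
                         (Then (Pop i) (Then (Push j true) (Push k true)))).

(** Pouring reverses a stack; the detour through [aux] restores the order and the source. *)
Definition copy (i j aux : nat) : cmd := Then (pour i aux) (pour2 aux i j).

Definition clear (i : nat) : cmd := While i (Pop i).

Ltac decide_eqs :=
  repeat (match goal with |- context [if ?x == ?y then _ else _] =>
            let E := fresh "E" in
            have [E|E] := eqVneq x y; [try rewrite E | ] end);
  try by []; try lia; try congruence.

(** Each bit costs 5 steps: loop test, branch and pop take one each, the push two. *)
Lemma exec_pour i j s s' t : i != j ->
  s' =1 upd (upd s j (catrev (s i) (s j))) i [::] -> 5 * size (s i) < t ->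
  exec (pour i j) s s' t.
Proof.
move=> nij; move: {2}(s i) (erefl (s i)) => u; elim: u s t => [|b u IHu] s t si e lt_t.
  apply: exec_while_nil => //; last lia.
  by move=> k; rewrite e /upd si /=; decide_eqs.
pose s1 := upd (upd s i u) j (b :: s j).
have si1 : s1 i = u by rewrite /s1 /upd; decide_eqs.
apply: (@exec_while_cons _ _ _ s1 _ 4 t.-2.-2.-1); first by rewrite si.
- apply: exec_branch (_ : 3 < 4) => //; rewrite si.
  rewrite [select _ _ _ _](_ : _ = Then (Pop i) (Push j b)); last by case: (b).
  apply: (@exec_then _ _ _ (upd s i u) _ 1 2) => //.
    by apply: exec_pop => //; rewrite si.
  by apply: exec_push => // l; rewrite /s1 /upd; decide_eqs.
- apply: IHu; rewrite ?si1 //; last by move: lt_t; rewrite si /=; lia.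
  by move=> k; rewrite e /s1 /upd si /=; decide_eqs.
- by move: lt_t; rewrite si /=; lia.
Qed.

Lemma exec_pour2 i j k s s' t : i != j -> i != k -> j != k ->
  s' =1 upd (upd (upd s k (catrev (s i) (s k))) j (catrev (s i) (s j))) i [::] ->
  7 * size (s i) < t -> exec (pour2 i j k) s s' t.
Proof.
move=> nij nik njk; move: {2}(s i) (erefl (s i)) => u.
elim: u s t => [|b u IHu] s t si e lt_t.
  apply: exec_while_nil => //; last lia.
  by move=> l; rewrite e /upd si /=; decide_eqs.
pose s1 := upd (upd (upd s i u) j (b :: s j)) k (b :: s k).
have si1 : s1 i = u by rewrite /s1 /upd; decide_eqs.
apply: (@exec_while_cons _ _ _ s1 _ 6 (t - 7)); first by rewrite si.
- apply: exec_branch (_ : 5 < 6) => //; rewrite si.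
  rewrite [select _ _ _ _](_ : _ = Then (Pop i) (Then (Push j b) (Push k b)));
    last by case: (b).
  apply: (@exec_then _ _ _ (upd s i u) _ 1 4) => //.
    by apply: exec_pop => //; rewrite si.
  apply: (@exec_then _ _ _ (upd (upd s i u) j (b :: s j)) _ 2 2) => //.
    by apply: exec_push => // l; rewrite /s1 /upd; decide_eqs.
  by apply: exec_push => // l; rewrite /s1 /upd; decide_eqs.
- apply: IHu; rewrite ?si1 //; last by move: lt_t; rewrite si /=; lia.
  by move=> l; rewrite e /s1 /upd si /=; decide_eqs.
- by move: lt_t; rewrite si /=; lia.
Qed.

Lemma exec_copy i j aux s s' t : i != aux -> j != aux -> i != j ->
  s j = [::] -> s aux = [::] -> s' =1 upd s j (s i) ->
  12 * size (s i) + 1 < t -> exec (copy i j aux) s s' t.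
Proof.
move=> nia nja nij sj saux e lt_t.
pose s1 := upd (upd s aux (rev (s i))) i [::].
have s1E : s1 aux = rev (s i) by rewrite /s1 /upd; decide_eqs.
apply: (@exec_then _ _ _ s1 _ (5 * size (s i)).+1 (7 * size (s i)).+1); last lia.
  by apply: exec_pour => //; rewrite saux.
apply: exec_pour2 => //; try (by rewrite eq_sym); last by rewrite s1E size_rev.
move=> l; rewrite e s1E /upd /s1 /upd; decide_eqs; rewrite ?sj ?saux //.
- by rewrite -[catrev _ _]/(rev _) revK.
- by rewrite -[catrev _ _]/(rev _) revK.
Qed.

Lemma exec_clear i s s' t : s' =1 upd s i [::] -> 2 * size (s i) < t ->
  exec (clear i) s s' t.
Proof.
move: {2}(s i) (erefl (s i)) => u; elim: u s t => [|b u IHu] s t si e lt_t.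
  apply: exec_while_nil => //; last lia.
  by move=> k; rewrite e /upd; decide_eqs.
pose s1 := upd s i u.
have si1 : s1 i = u by rewrite /s1 /upd; decide_eqs.
apply: (@exec_while_cons _ _ _ s1 _ 1 t.-2); first by rewrite si.
- by apply: exec_pop => //; rewrite si.
- apply: IHu; rewrite ?si1 //; last by move: lt_t; rewrite si /=; lia.
  by move=> l; rewrite e /s1 /upd; decide_eqs.
- by move: lt_t; rewrite si /=; lia.
Qed.

(** * A language of polynomial time in a cap *)

(* Variables are de Bruijn levels. [Iter n z s] binds two of them: the counter,
   which runs through the nonempty suffixes of [n], and the accumulator. *)
Inductive expr :=
  | Var of nat
  | Nil
  | Cons of bool & expr
  | Tail of expr
  | Case of expr & expr & expr & expr
  | Iter of expr & expr & expr.

Fixpoint iter_suffix (f : bitseq -> bitseq -> bitseq) (l acc : bitseq) : bitseq :=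
  if l is _ :: l' then iter_suffix f l' (f l acc) else acc.

(* [Cons] does nothing on values as long as variable 0: this is what bounds the
   evaluation time polynomially in the length of variable 0. *)
Fixpoint eval (env : seq (seq bool)) (e : expr) : bitseq :=
  match e with
  | Var i => nth [::] env i
  | Nil => [::]
  | Cons b e => let v := eval env e in
      if size v < size (nth [::] env 0) then b :: v else v
  | Tail e => behead (eval env e)
  | Case c e0 e1 e2 =>
      select (eval env c) (eval env e0) (eval env e1) (eval env e2)
  | Iter n z s => let v := eval env n in
      iter_suffix (fun l acc => eval (env ++ [:: l; acc]) s) v
        (eval (rcons env v) z)
  end.

(** Calling convention: the stacks below [d] hold the environment and are preserved, those from [d]
    on are empty, and the value is left on stack [d]. For [Cons], a copy of the cap loses one symbol
    per symbol of the value, and what remains is nonempty exactly when there is room. *)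
Fixpoint compile (d : nat) (e : expr) : cmd :=
  match e with
  | Var i => if i < d then copy i d d.+1 else Skip
  | Nil => Skip
  | Cons b e =>
      Then (compile d e)
     (Then (copy d d.+1 d.+2)
     (Then (copy 0 d.+2 d.+3)
     (Then (While d.+1 (Then (Pop d.+1) (Pop d.+2)))
           (Branch d.+2 Skip (Then (clear d.+2) (Push d b))
                             (Then (clear d.+2) (Push d b))))))
  | Tail e => Then (compile d e) (Pop d)
  | Case c e0 e1 e2 =>
      Then (compile d c)
           (Branch d (Then (clear d) (compile d e0)) (Then (clear d) (compile d e1))
                                    (Then (clear d) (compile d e2)))
  | Iter n z s =>
      Then (compile d n)
     (Then (compile d.+1 z)
     (Then (While d (Then (compile d.+2 s)
                    (Then (clear d.+1)
                    (Then (pour d.+2 d.+3) (Then (pour d.+3 d.+1) (Pop d))))))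
     (Then (pour d.+1 d.+2) (pour d.+2 d))))
  end.

(** In a round of [Iter], [12 * N + 5] pays for clearing the old accumulator, pouring the new one
    twice, the pop and the loop test. *)
Fixpoint cost (e : expr) (N : nat) : nat :=
  match e with
  | Var _ => 12 * N + 2
  | Nil => 1
  | Cons _ e => cost e N + 30 * N + 10
  | Tail e => cost e N + 1
  | Case c e0 e1 e2 =>
      cost c N + cost e0 N + cost e1 N + cost e2 N + 2 * N + 3
  | Iter n z s => cost n N + cost z N + N * (cost s N + 12 * N + 5) + 10 * N + 4
  end.

Definition st (env : seq (seq bool)) : store := nth [::] env.

Ltac st_eq :=
  let j := fresh "j" in let h := fresh "h" in
  move=> j; rewrite /upd /st -?cats1 ?cats0 ?nth_cat;
  case: ltnP => h; [decide_eqs |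
  rewrite -(subnKC h); move: (j - _) => {h}j; rewrite ?addKn;
  do 4?[case: j => [|j] //=]; decide_eqs;
  rewrite ?nth_nil ?[nth [::] _ (_ + _)]nth_default //=; decide_eqs;
  try (by rewrite nth_default //; lia); lia ].

Lemma st_cat env w i : st (env ++ w) (size env + i) = nth [::] w i.
Proof. by rewrite /st nth_cat ltnNge leq_addr addKn. Qed.

Lemma st_at env w :
  (st (env ++ w) (size env) = nth [::] w 0) *
  (st (env ++ w) (size env).+1 = nth [::] w 1) *
  (st (env ++ w) (size env).+2 = nth [::] w 2) *
  (st (env ++ w) (size env).+3 = nth [::] w 3).
Proof.
by do !split; rewrite -?[(size env).+3]addn3 -?[(size env).+2]addn2
  -?[(size env).+1]addn1 ?st_cat // -[X in st _ X]addn0 st_cat.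
Qed.

Lemma exec_drop i j s s' t : i != j ->
  s' =1 upd (upd s j (drop (size (s i)) (s j))) i [::] -> 3 * size (s i) < t ->
  exec (While i (Then (Pop i) (Pop j))) s s' t.
Proof.
move=> nij; move: {2}(s i) (erefl (s i)) => u; elim: u s t => [|b u IHu] s t si e lt_t.
  apply: exec_while_nil => //; last lia.
  by move=> k; rewrite e /upd si drop0; decide_eqs.
pose s1 := upd (upd s i u) j (behead (s j)).
have si1 : s1 i = u by rewrite /s1 /upd; decide_eqs.
apply: (@exec_while_cons _ _ _ s1 _ 2 (t - 3)); first by rewrite si.
- apply: (@exec_then _ _ _ (upd s i u) _ 1 1) => //.
    by apply: exec_pop => //; rewrite si.
  by apply: exec_pop => // l; rewrite /s1 /upd; decide_eqs.
- apply: IHu; rewrite ?si1 //; last by move: lt_t; rewrite si /=; lia.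
  move=> l; rewrite e /s1 /upd si /=; decide_eqs.
  by case: (s j).
- by move: lt_t; rewrite si /=; lia.
Qed.

Section Compile.
Variable N : nat.

Definition bounded (env : seq (seq bool)) : Prop :=
  [/\ 0 < size env, size (nth [::] env 0) = N & all (fun v => size v <= N) env].

Lemma bounded_cat env w : bounded env -> all (fun v => size v <= N) w ->
  bounded (env ++ w).
Proof.
case=> d0 uN bw b; split; first by rewrite size_cat; lia.
  by rewrite nth_cat d0.
by rewrite all_cat bw.
Qed.

Lemma bounded_nth env i : bounded env -> size (nth [::] env i) <= N.
Proof.
case=> _ _ /all_nthP b; case: (ltnP i (size env)) => h; first exact: b.
by rewrite nth_default.
Qed.

Lemma size_iter_suffix f l acc :
  (forall l' acc', size l' <= N -> size acc' <= N -> size (f l' acc') <= N) ->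
  size l <= N -> size acc <= N -> size (iter_suffix f l acc) <= N.
Proof.
move=> Hf; elim: l acc => //= b l IHl acc bl bacc.
by apply: IHl; [lia | apply: Hf].
Qed.

Lemma size_eval e env : bounded env -> size (eval env e) <= N.
Proof.
elim: e env => /= [i|//|b e IHe|e IHe|c IHc e0 IH0 e1 IH1 e2 IH2|n IHn z IHz s IHs] env benv.
- exact: bounded_nth.
- by have [_ -> _] := benv; have := IHe _ benv; case: ifP.
- by rewrite size_behead; have := IHe _ benv; lia.
- by case: (eval env c) => [|[] _] /=; auto.
- apply: size_iter_suffix; auto.
    by move=> l acc bl bacc; apply: IHs; apply: bounded_cat => //=; rewrite bl bacc.
  by apply: IHz; rewrite -cats1; apply: bounded_cat => //=; rewrite IHn.
Qed.

Lemma exec_compile e env : bounded env ->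
  exec (compile (size env) e) (st env) (st (rcons env (eval env e))) (cost e N).
Proof.
elim: e env => /= [i||b e IHe|e IHe|c IHc e0 IH0 e1 IH1 e2 IH2|n IHn z IHz s IHs] env benv.
- case: ltnP => hi.
    have bi := bounded_nth i benv.
    apply: exec_copy; rewrite -?[nth [::] env i]/(st env i); try lia.
    - by rewrite /st nth_default.
    - by rewrite /st nth_default.
    - by move: (st env i) => w; st_eq.
    - by rewrite -/(st env i) in bi; lia.
  by apply: exec_skip; [rewrite nth_default //; st_eq | lia].
- by apply: exec_skip => //; st_eq.
- have bv := size_eval e benv; move: (IHe _ benv); move: (eval env e) bv => v bv Ev.
  have [d0 uN _] := benv; set u := nth [::] env 0 in uN *.
  have st0 w : st (env ++ w) 0 = u by rewrite /st nth_cat d0.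
  rewrite -!cats1 in Ev *.
  apply: (exec_then Ev (t2 := 30 * N + 10)); last lia.
  apply: (@exec_then _ _ _ (st (env ++ [:: v; v])) _ (12 * N + 2) (18 * N + 8)); last lia.
    by apply: exec_copy; rewrite ?st_at //=; try lia; st_eq.
  apply: (@exec_then _ _ _ (st (env ++ [:: v; v; u])) _ (12 * N + 2) (6 * N + 6)); last lia.
    by apply: exec_copy; rewrite ?st_at ?st0 //=; try lia; st_eq.
  apply: (@exec_then _ _ _ (st (env ++ [:: v; [::]; drop (size v) u])) _
           (3 * N + 1) (3 * N + 5)); last lia.
    by apply: exec_drop; rewrite ?st_at //=; try lia; st_eq.
  apply: (@exec_branch _ _ _ _ _ _ (3 * N + 4)); last lia.
  rewrite st_at /= uN.
  (* What is left of the copied cap decides between pushing and leaving the value alone. *)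
  have : size (drop (size v) u) = N - size v by rewrite size_drop uN.
  case: ltnP => h.
    case: (drop _ _) => [/= ?|b' l sl]; first lia.
    rewrite [select _ _ _ _](_ : _ = Then (clear (size env).+2) (Push (size env) b));
      last by case: (b').
    apply: (@exec_then _ _ _ (st (env ++ [:: v])) _ (2 * N + 1) 2); last lia.
      by apply: exec_clear; rewrite ?st_at //=; [st_eq | move: sl => /=; lia].
    by apply: exec_push => //; rewrite ?st_at; st_eq.
  case: (drop _ _) => [_|b' l /= ?]; last lia.
  by apply: exec_skip; [st_eq | lia].
- have := IHe _ benv; rewrite -!cats1 => Ee.
  apply: (exec_then Ee (t2 := 1)) => //.
  by apply: exec_pop => //; rewrite st_at; st_eq.
- have bc := size_eval c benv; move: (IHc _ benv); move: (eval env c) bc => v bv Ec.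
  rewrite -!cats1 in Ec *.
  apply: (exec_then Ec (t2 := cost e0 N + cost e1 N + cost e2 N + 2 * N + 3)); last lia.
  apply: (@exec_branch _ _ _ _ _ _ (cost e0 N + cost e1 N + cost e2 N + 2 * N + 2)); last lia.
  have clr e' : exec (compile (size env) e') (st env) (st (rcons env (eval env e'))) (cost e' N) ->
     exec (Then (clear (size env)) (compile (size env) e')) (st (env ++ [:: v]))
       (st (env ++ [:: eval env e'])) (cost e' N + 2 * N + 2).
    rewrite -cats1 => E'; apply: (exec_then _ E' (t1 := 2 * N + 1)); last lia.
    by apply: exec_clear; rewrite ?st_at //=; [st_eq | lia].
  rewrite st_at /=; case: v bv Ec clr => [|[] v] /= bv Ec clr.
  + by apply: exec_le (clr _ (IH0 _ benv)); lia.
  + by apply: exec_le (clr _ (IH2 _ benv)); lia.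
  + by apply: exec_le (clr _ (IH1 _ benv)); lia.
- have bn := size_eval n benv; move: (IHn _ benv); move: (eval env n) bn => v bv En.
  rewrite -cats1 in En *.
  have benv' : bounded (env ++ [:: v]) by apply: bounded_cat => //=; rewrite bv.
  have bz := size_eval z benv'; move: (IHz _ benv').
  move: (eval _ z) bz => acc bacc Ez.
  rewrite size_cat addn1 -cats1 -catA /= in Ez.
  apply: (exec_then En (t2 := cost z N + N * (cost s N + 12 * N + 5) + 10 * N + 4)); last lia.
  apply: (exec_then Ez (t2 := N * (cost s N + 12 * N + 5) + 10 * N + 4)); last lia.
  set f := fun l acc => _.
  have bf l a : size l <= N -> size a <= N -> size (f l a) <= N.
    by move=> bl ba; apply: size_eval; apply: bounded_cat; rewrite //= bl ba.
  have bres : size (iter_suffix f v acc) <= N by apply: size_iter_suffix.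
  apply: (@exec_then _ _ _ (st (env ++ [:: [::]; iter_suffix f v acc])) _
           (N * (cost s N + 12 * N + 5) + 1) (10 * N + 3)); last lia; last first.
    apply: (@exec_then _ _ _ (st (env ++ [:: [::]; [::]; rev (iter_suffix f v acc)])) _
           (5 * N + 1) (5 * N + 2)); last lia.
      by apply: exec_pour; rewrite ?st_at //=; try lia; st_eq.
    apply: exec_pour; rewrite ?st_at //= ?size_rev; try lia.
    by rewrite -[catrev _ _]/(rev _) revK; st_eq.
  (* The bound with the actual number of rounds is what the induction on the counter [v] can prove;
     [size v <= N] gives the stated one. *)
  apply: (@exec_le _ _ _ (size v * (cost s N + 12 * N + 5) + 1)); first nia.
  elim: v acc bv bacc {En benv' Ez bres} => [|b v IHv] acc bv bacc.
    by apply: exec_while_nil; rewrite ?st_at.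
  have ba' : size (f (b :: v) acc) <= N by apply: bf.
  apply: (@exec_while_cons _ _ _ (st (env ++ [:: v; f (b :: v) acc])) _
    (cost s N + 12 * N + 4) (size v * (cost s N + 12 * N + 5) + 1)); first by rewrite st_at.
  + have := IHs (env ++ [:: b :: v; acc]); rewrite size_cat addn2 -cats1 -catA /= => Es.
    apply: (exec_then (Es _) (t2 := 12 * N + 4)); last lia.
      by apply: bounded_cat; rewrite //= bv bacc.
    rewrite -/(f _ _); move: (f _ _) ba' => r br.
    apply: (@exec_then _ _ _ (st (env ++ [:: b :: v; [::]; r])) _ (2 * N + 1) (10 * N + 3)); last lia.
      by apply: exec_clear; rewrite ?st_at //=; [st_eq | lia].
    apply: (@exec_then _ _ _ (st (env ++ [:: b :: v; [::]; [::]; rev r])) _ (5 * N + 1) (5 * N + 2)); last lia.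
      by apply: exec_pour; rewrite ?st_at //=; try lia; st_eq.
    apply: (@exec_then _ _ _ (st (env ++ [:: b :: v; r])) _ (5 * N + 1) 1); last lia.
      apply: exec_pour; rewrite ?st_at //= ?size_rev; try lia.
      by rewrite -[catrev _ _]/(rev _) revK; st_eq.
    by apply: exec_pop => //; rewrite st_at; st_eq.
  + by apply: IHv => //; move: bv => /=; lia.
  + by rewrite /=; lia.
Qed.
End Compile.

(** The base [N + 2] is at least 2, so a single exponent absorbs coefficients and constants. *)
Definition poly_bounded (f : nat -> nat) : Prop :=
  exists a, forall N, f N <= (N + 2) ^ a.

Lemma poly_bounded_const c : poly_bounded (fun=> c).
Proof.
exists c => N; apply: (@leq_trans (2 ^ c)); first by apply: ltnW; apply: ltn_expl.
by case: c => // c; rewrite leq_exp2r // addn2.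
Qed.

Lemma poly_bounded_id : poly_bounded id.
Proof. by exists 1 => N; rewrite expn1 leq_addr. Qed.

Lemma poly_bounded_mul f g :
  poly_bounded f -> poly_bounded g -> poly_bounded (fun N => f N * g N).
Proof. by move=> [a Ha] [b Hb]; exists (a + b) => N; rewrite expnD leq_mul. Qed.

Lemma poly_bounded_add f g :
  poly_bounded f -> poly_bounded g -> poly_bounded (fun N => f N + g N).
Proof.
move=> [a Ha] [b Hb]; exists (a + b).+1 => N.
have le_exp c : c <= a + b -> (N + 2) ^ c <= (N + 2) ^ (a + b).
  by move=> le_c; rewrite leq_exp2l // addn2.
rewrite expnS; apply: (@leq_trans (2 * (N + 2) ^ (a + b))); last by rewrite leq_mul2r addn2 orbT.
by rewrite mul2n -addnn leq_add // (leq_trans (Ha N), leq_trans (Hb N)) // le_exp // (leq_addr, leq_addl).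
Qed.

Ltac poly_bounded :=
  repeat (apply: poly_bounded_add || apply: poly_bounded_mul ||
          apply: poly_bounded_const || apply: poly_bounded_id || assumption).

Lemma cost_poly e : poly_bounded (cost e).
Proof. by elim: e => *; rewrite /cost -/cost; poly_bounded. Qed.

(** One doubling of tape 0 per symbol of tape 2. The marks are all equal, so the reversal by [pour]
    is harmless. *)
Definition double : cmd := While 2 (Then (copy 0 3 4) (Then (pour 3 0) (Pop 2))).

(* Tape 1 carries the input [x] and then the output; tape 0 gets [2 ^ size x] marks. *)
Definition program (e : expr) : cmd :=
  Then (Push 0 true) (Then (copy 1 2 3) (Then double (Then (compile 2 e)
    (Then (clear 1) (Then (pour 2 3) (pour 3 1)))))).

Ltac st_eq0 := let j := fresh "j" in
  move=> j; rewrite /upd /st; do 5?[case: j => [|j] //=]; rewrite ?nth_nil //=.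

(** [B] bounds the final number of marks, hence every intermediate one, which gives all rounds the
    same cost [17 * B + 5]. *)
Lemma exec_double x l M B t : M * 2 ^ size l <= B ->
  size l * (17 * B + 5) < t ->
  exec double (st [:: nseq M true; x; l]) (st [:: nseq (M * 2 ^ size l) true; x]) t.
Proof.
elim: l M t => [|b l IHl] M t leB lt_t.
  by rewrite muln1; apply: exec_while_nil => //; try lia; st_eq0.
have := leB; rewrite /= expnS mulnA => leB'.
have le1 : M * 2 <= B by have := expn_gt0 2 (size l); nia.
apply: (@exec_while_cons _ _ _ (st [:: nseq (M * 2) true; x; l]) _ (17 * B + 4)
          (size l * (17 * B + 5)).+1) => //; last by move: lt_t => /=; lia.
  apply: (@exec_then _ _ _ (st [:: nseq M true; x; b :: l; nseq M true]) _
           (12 * B + 2) (5 * B + 2)); last lia.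
    by apply: exec_copy; rewrite //= ?size_nseq //; try lia; st_eq0.
  apply: (@exec_then _ _ _ (st [:: nseq (M * 2) true; x; b :: l]) _ (5 * B + 1) 1); last lia.
    apply: exec_pour; rewrite //= ?size_nseq //; last lia.
    have -> : catrev (nseq M true) (nseq M true) = nseq (M * 2) true.
      by rewrite muln2 -addnn nseqD -[X in _ = X ++ _]rev_nseq -catrevE.
    by st_eq0.
  by apply: exec_pop => //; st_eq0.
by apply: IHl.
Qed.

Lemma exec_program e x (N := 2 ^ size x) :
  exists2 s : store, s 1 = eval [:: nseq N true; x] e &
    exec (program e) (upd (fun=> [::]) 1 x) s (cost e N + N * (17 * N + 5) + 24 * N + 10).
Proof.
set env := [:: _; _].
have xN : size x <= N by apply: ltnW; apply: ltn_expl.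
have benv : bounded N env by split; rewrite //= ?size_nseq // xN leqnn.
have bv := size_eval e benv; set v := eval env e in bv *.
exists (st [:: nseq N true; v]) => //.
apply: (@exec_then _ _ _ (st [:: [:: true]; x]) _ 2 (cost e N + N * (17 * N + 5) + 24 * N + 8)); last lia.
  by apply: exec_push => //; st_eq0.
apply: (@exec_then _ _ _ (st [:: [:: true]; x; x]) _ (12 * N + 2)
   (cost e N + N * (17 * N + 5) + 12 * N + 6)); last lia.
  by apply: exec_copy; rewrite //=; try lia; st_eq0.
apply: (@exec_then _ _ _ (st env) _ (N * (17 * N + 5)).+1 (cost e N + 12 * N + 5)); last lia.
  have := @exec_double x x 1 N (N * (17 * N + 5)).+1; rewrite mul1n; apply=> //.
  by rewrite ltnS leq_mul2r xN orbT.
apply: (@exec_then _ _ _ (st (rcons env v)) _ (cost e N) (12 * N + 5)); last lia.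
  exact: (exec_compile e benv).
apply: (@exec_then _ _ _ (st [:: nseq N true; [::]; v]) _ (2 * N + 1) (10 * N + 4)); last lia.
  by apply: exec_clear; rewrite //=; try lia; st_eq0.
apply: (@exec_then _ _ _ (st [:: nseq N true; [::]; [::]; rev v]) _ (5 * N + 1) (5 * N + 3)); last lia.
  by apply: exec_pour; rewrite //=; try lia; st_eq0.
apply: exec_pour; rewrite //= ?size_rev; last lia.
by rewrite -[catrev _ _]/(rev _) revK; st_eq0.
Qed.

Theorem eval_in_EXPTIME e : exists (M : TM) (p : {poly nat}), forall x,
  tm_computes_within M (2 ^ p.[size x]%R) x (eval [:: nseq (2 ^ size x) true; x] e).
Proof.
have [a Ha] : poly_bounded (fun N => cost e N + N * (17 * N + 5) + 24 * N + 10).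
  by have ce := cost_poly e; poly_bounded.
exists (stack_TM (cmd_tapes (program e)) (program e)).
(* With [N = 2 ^ size x], [N + 2] is at most [2 ^ (size x + 2)]; raise this to the power [a]. *)
exists (a%:P * 'X + (a * 2)%:P)%R => x.
have [s <- E] := exec_program e x.
apply: exec_computes E _ _; first lia.
apply: leq_trans (Ha _) _.
rewrite hornerD hornerM !hornerC hornerX.
have -> : (a * size x + a * 2)%R = ((size x + 2) * a)%N.
  by rewrite -[LHS]/(a * size x + a * 2)%N; lia.
rewrite expnM; case: a {Ha} => // a; rewrite leq_exp2r // expnD.
have := expn_gt0 2 (size x); lia.
Qed.

(** * Writing programs *)

(* An expression still waiting for its binding depth: this makes binders of the
   metalanguage available for writing programs. *)
Definition term := nat -> expr.

Definition tVar (i : nat) : term := fun=> Var i.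
Definition tNil : term := fun=> Nil.
Definition tCons (b : bool) (e : term) : term := fun d => Cons b (e d).
Definition tTail (e : term) : term := fun d => Tail (e d).
Definition tCase (c e0 e1 e2 : term) : term :=
  fun d => Case (c d) (e0 d) (e1 d) (e2 d).
(** The body gets the tail of the current suffix, so its index runs from the length of [n] minus one
    down to 0. *)
Definition tIter (n z : term) (s : term -> term -> term) : term :=
  fun d => Iter (n d) (z d.+1) (s (tTail (tVar d)) (tVar d.+1) d.+2).

(* Booleans are heads of lists and numbers are lengths of lists. *)
Definition tTrue := tCons true tNil.
Definition tIf (c a b : term) := tCase c b b a.
Definition tNot a := tIf a tNil tTrue.
Definition tAnd a b := tIf a b tNil.
Definition tOr a b := tIf a tTrue b.
Definition tImp a b := tIf a b tTrue.
Definition tIs0 a := tCase a tTrue tNil tNil.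
Definition tSucc a := tCons true a.
Definition tAdd a b := tIter a b (fun _ acc => tSucc acc).
Definition tMul a b := tIter a tNil (fun _ acc => tAdd b acc).
Definition tSub a b := tIter b a (fun _ acc => tTail acc).
Definition tEq a b := tAnd (tIs0 (tSub a b)) (tIs0 (tSub b a)).
Definition tNth t i := tIter i t (fun _ acc => tTail acc).
Definition tEx n (p : term -> term) := tIter n tNil (fun i acc => tIf (p i) tTrue acc).
Definition tAll n (p : term -> term) := tNot (tEx n (fun i => tNot (p i))).
Definition tCount n (p : term -> term) :=
  tIter n tNil (fun i acc => tIf (p i) (tSucc acc) acc).
(** Indices come in decreasing order, so consing puts entry 0 at the head. *)
Definition tTab (p : term -> term) :=
  tIter (tVar 0) tNil (fun i acc => tIf (p i) (tCons true acc) (tCons false acc)).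
Definition tOdd a := tIter a tNil (fun _ acc => tNot acc).
(** Division by two without division: [k./2] is the number of odd numbers below [k]. *)
Definition tHalf a := tCount a tOdd.
Definition tBit i a := tOdd (tIter i a (fun _ acc => tHalf acc)).

Definition bit (i k : nat) : bool := odd (iter i half k).

Section Denotation.
Variables cap x : seq bool.
Notation N := (size cap).

(** Quantifying over all extensions of [env], as in Kripke semantics, lets a fact proved about a
    term be used under further binders. *)
Definition denP (env : seq (seq bool)) (e : term) (P : seq bool -> Prop) : Prop :=
  forall env', prefix [:: cap; x] env' -> prefix env env' ->
    P (eval env' (e (size env'))).

(* Arithmetic saturates at [N]. *)
Definition denN env e k := denP env e (fun v => size v = minn N k).
Definition denB env e b := denP env e (fun v => head false v = b).
Definition denT env e (f : nat -> bool) :=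
  denP env e (fun v => forall k, nth false v k = (k < N) && f k).

Lemma denP_mono env env' e P : prefix env env' -> denP env e P -> denP env' e P.
Proof. by move=> h H env1 b1 p1; apply: H => //; apply: prefix_trans p1. Qed.

Lemma denP_imp env e (P Q : _ -> Prop) :
  (forall v, P v -> Q v) -> denP env e P -> denP env e Q.
Proof. by move=> h H env1 b1 p1; apply: h; apply: H. Qed.

Lemma denP_nil env (P : _ -> Prop) : P [::] -> denP env tNil P.
Proof. by move=> h env1 _ _. Qed.

Lemma base_cap env : prefix [:: cap; x] env -> nth [::] env 0 = cap.
Proof. by case/prefixP=> w ->. Qed.

Lemma denP_cap env (P : _ -> Prop) : P cap -> denP env (tVar 0) P.
Proof. by move=> h env1 b1 _ /=; rewrite base_cap. Qed.

Lemma denP_input env (P : _ -> Prop) : P x -> denP env (tVar 1) P.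
Proof. by move=> h env1 /prefixP[w ->] _. Qed.

Lemma denP_cons env b e (P : _ -> Prop) :
  denP env e (fun v => P (if size v < N then b :: v else v)) ->
  denP env (tCons b e) P.
Proof. by move=> H env1 b1 p1; rewrite /= base_cap //; apply: H. Qed.

Lemma denP_tail env e (P : _ -> Prop) :
  denP env e (fun v => P (behead v)) -> denP env (tTail e) P.
Proof. by move=> H env1 b1 p1; apply: H. Qed.

Lemma denP_if env c a b p (P : _ -> Prop) : denB env c p ->
  (p -> denP env a P) -> (~~ p -> denP env b P) -> denP env (tIf c a b) P.
Proof.
move=> Hc Ha Hb env1 b1 p1; move: (Hc _ b1 p1); rewrite /=.
by case: (eval _ _) => [|[] v] /= e; rewrite -e in Ha Hb;
  [apply: Hb | apply: Ha | apply: Hb].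
Qed.

(** Loop rule: [Inv j] describes the accumulator when [j] rounds remain, and the round with index
    [j] leads from [Inv j.+1] to [Inv j]. *)
Lemma denP_iter env n z s k (Inv : nat -> seq bool -> Prop) :
  denP env n (fun v => size v = k) -> denP env z (Inv k) ->
  (forall env' i acc j, prefix env env' -> j < k ->
     denP env' i (fun v => size v = j) -> denP env' acc (Inv j.+1) ->
     denP env' (s i acc) (Inv j)) ->
  denP env (tIter n z s) (Inv 0).
Proof.
move=> Hn Hz Hs env1 b1 p1; rewrite /=.
have := Hn _ b1 p1; move: (eval env1 _) => v sv.
have pc w : prefix env1 (env1 ++ w) by apply: prefix_prefix.
have : Inv k (eval (rcons env1 v) (z (size env1).+1)).
  by rewrite -cats1 -addn1 -[1]/(size [:: v]) -size_cat; apply: Hz;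
    [apply: prefix_trans (pc _) | apply: prefix_trans (pc _)].
have lek : size v <= k by rewrite sv.
rewrite -[in Inv k _]sv; move: (eval _ (z _)) => acc.
elim: v acc lek {sv} => [|b v IHv] acc //= lt_v Ia.
apply: IHv; first exact: ltnW.
set env2 := env1 ++ _.
have -> : (size env1).+2 = size env2 by rewrite size_cat addn2.
have nth_env2 env3 : prefix env2 env3 ->
    nth [::] env3 (size env1) = b :: v /\ nth [::] env3 (size env1).+1 = acc.
  case/prefixP=> w ->; rewrite -catA !nth_cat ltnn subnn.
  have -> : ((size env1).+1 < size env1) = false by lia.
  by rewrite subSnn.
apply: (Hs env2) => //.
- exact: prefix_trans (pc _).
- by move=> env3 b3 p3 /=; rewrite (nth_env2 _ p3).1.
- by move=> env3 b3 p3 /=; rewrite (nth_env2 _ p3).2.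
- exact: prefix_trans (pc _).
- exact: prefix_refl.
Qed.

Hypothesis N_gt0 : 0 < N.

Lemma denB_eq env e b b' : b = b' -> denB env e b -> denB env e b'.
Proof. by move=> ->. Qed.

Lemma denB_true env : denB env tTrue true.
Proof. by apply: denP_cons; apply: denP_nil; rewrite N_gt0. Qed.

Lemma denB_not env a p : denB env a p -> denB env (tNot a) (~~ p).
Proof.
by move=> Ha; apply: denP_if Ha _ _; case: p => // _; apply: denB_true.
Qed.

Lemma denB_and env a b p q : denB env a p -> denB env b q -> denB env (tAnd a b) (p && q).
Proof. by move=> Ha Hb; apply: denP_if Ha _ _; case: p. Qed.

Lemma denB_or env a b p q : denB env a p -> denB env b q -> denB env (tOr a b) (p || q).
Proof. by move=> Ha Hb; apply: denP_if Ha _ _; case: p => // _; apply: denB_true. Qed.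

Lemma denB_imp env a b p q : denB env a p -> denB env b q -> denB env (tImp a b) (p ==> q).
Proof. by move=> Ha Hb; apply: denP_if Ha _ _; case: p => // _; apply: denB_true. Qed.

Lemma denB_if env c a b p q r : denB env c p -> denB env a q -> denB env b r ->
  denB env (tIf c a b) (if p then q else r).
Proof. by move=> Hc Ha Hb; apply: denP_if Hc _ _; case: p. Qed.

Lemma denB_is0 env a k : denN env a k -> denB env (tIs0 a) (k == 0).
Proof.
move=> Ha env1 b1 p1; have := Ha _ b1 p1; rewrite /= (base_cap b1) N_gt0.
by case: (eval _ _) => [|[] v] /= ?; lia.
Qed.

Lemma denN_lt env i j : j < N -> denP env i (fun v => size v = j) -> denN env i j.
Proof. by move=> lt_j; apply: denP_imp => v ->; lia. Qed.

Lemma denN_cap env : denN env (tVar 0) N.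
Proof. by apply: denP_cap; rewrite minnn. Qed.

Lemma denN_succ env a k : denN env a k -> denN env (tSucc a) k.+1.
Proof.
move=> Ha; apply: denP_cons; apply: denP_imp Ha => v sv.
by case: ifP => /=; lia.
Qed.

Lemma denN_add env a b k l : denN env a k -> denN env b l -> denN env (tAdd a b) (k + l).
Proof.
move=> Ha Hb; apply: denP_imp (denP_iter (Inv := fun j v => size v = minn N (minn N k - j + l)) Ha _ _).
- by move=> v; lia.
- by apply: denP_imp Hb => v; lia.
- move=> env' i acc j p lt_j Hi Hacc; apply: denP_cons; apply: denP_imp Hacc => v.
  by case: ifP => /=; lia.
Qed.

Lemma denN_mul env a b k l : denN env a k -> denN env b l -> denN env (tMul a b) (k * l).
Proof.
move=> Ha Hb.
apply: denP_imp (denP_iter (Inv := fun j v => size v = minn N ((minn N k - j) * l)) Ha _ _).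
- by move=> v ->; case: (leqP k N) => h; [congr minn; nia | case: l {Hb} => [|l]; nia].
- by apply: denP_nil => /=; lia.
- move=> env' i acc j p lt_j Hi Hacc.
  apply: denP_imp (denN_add (denP_mono p Hb) Hacc) => v ->; congr minn; nia.
Qed.

(** This is not a [denN] statement because truncated subtraction does not commute with
    saturation. *)
Lemma denP_sub env a b k l : denN env a k -> denN env b l ->
  denP env (tSub a b) (fun v => size v = minn N k - minn N l).
Proof.
move=> Ha Hb.
apply: denP_imp (denP_iter (Inv := fun j v => size v = minn N k - (minn N l - j)) Hb _ _).
- by move=> v; lia.
- by apply: denP_imp Ha => v; lia.
- move=> env' i acc j p lt_j Hi Hacc; apply: denP_tail; apply: denP_imp Hacc => v.
  by rewrite size_behead; lia.
Qed.

(** It suffices that one side lies below the cap: if the other one saturates, it still differs. *)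
Lemma denB_eqn env a b k l : k < N -> denN env a k -> denN env b l ->
  denB env (tEq a b) (k == l).
Proof.
move=> ltk Ha Hb.
have sub_le u v i j : denN env u i -> denN env v j -> denN env (tSub u v) (minn N i - minn N j).
  by move=> Hu Hv; apply: denP_imp (denP_sub Hu Hv) => w ->; lia.
apply: denB_eq (denB_and (denB_is0 (sub_le _ _ _ _ Ha Hb)) (denB_is0 (sub_le _ _ _ _ Hb Ha))).
by lia.
Qed.

Lemma denB_nth env t i k b : denP env t (fun v => nth false v (minn N k) = b) ->
  denN env i k -> denB env (tNth t i) b.
Proof.
move=> Ht Hi.
apply: denP_imp (denP_iter (Inv := fun j v => nth false v j = b) Hi Ht _).
- by move=> v <-; rewrite nth0.
- move=> env' i' acc j p lt_j Hi' Hacc; apply: denP_tail; apply: denP_imp Hacc => v <-.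
  by rewrite nth_behead.
Qed.

(** An index that is too large saturates to [N], where the table reads the default [false]. This is
    the origin of the guards [_ < N] in the decision procedure. *)
Lemma denB_tab env t f i k : denT env t f -> denN env i k ->
  denB env (tNth t i) ((k < N) && f k).
Proof.
move=> Ht; apply: denB_nth; apply: denP_imp Ht => v ->.
by case: (ltnP k N) => h; rewrite ?h // ltnn.
Qed.

Lemma denB_ex env n q k p : k <= N -> denN env n k ->
  (forall env' i j, prefix env env' -> j < k -> denN env' i j -> denB env' (q i) (p j)) ->
  denB env (tEx n q) (has p (iota 0 k)).
Proof.
move=> lek Hn Hq.
have := denP_iter (k := k) (Inv := fun j v => head false v = has p (iota j (k - j))) (n := n) (z := tNil).
rewrite subn0; apply.
- by apply: denP_imp Hn => v ->; lia.
- by apply: denP_nil; rewrite subnn.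
- move=> env' i acc j pre lt_j Hi Hacc.
  have -> : k - j = (k - j.+1).+1 by lia.
  apply: denB_eq (denB_or (Hq env' i j _ _ _) Hacc) => //.
  by apply: denN_lt Hi; lia.
Qed.

Lemma denB_all env n q k p : k <= N -> denN env n k ->
  (forall env' i j, prefix env env' -> j < k -> denN env' i j -> denB env' (q i) (p j)) ->
  denB env (tAll n q) (all p (iota 0 k)).
Proof.
move=> lek Hn Hq; apply: denB_eq (denB_not (denB_ex (p := fun i => ~~ p i) lek Hn _)).
  by rewrite -[RHS]negbK -has_predC.
by move=> *; apply: denB_not; apply: Hq.
Qed.

Lemma denN_count env n q k p : k <= N -> denN env n k ->
  (forall env' i j, prefix env env' -> j < k -> denN env' i j -> denB env' (q i) (p j)) ->
  denN env (tCount n q) (count p (iota 0 k)).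
Proof.
move=> lek Hn Hq.
have := denP_iter (k := k) (Inv := fun j v => size v = minn N (count p (iota j (k - j)))) (n := n) (z := tNil).
rewrite subn0; apply.
- by apply: denP_imp Hn => v ->; lia.
- by apply: denP_nil; rewrite subnn /=; lia.
- move=> env' i acc j pre lt_j Hi Hacc.
  have -> : k - j = (k - j.+1).+1 by lia.
  rewrite /=; apply: denP_if (Hq env' i j _ _ _) _ _ => //.
  + by apply: denN_lt Hi; lia.
  + by move=> ->; rewrite add1n; apply: denN_succ.
  + by move=> /negbTE ->; rewrite add0n.
Qed.

Lemma denT_tab env q f :
  (forall env' i j, prefix env env' -> j < N -> denN env' i j -> denB env' (q i) (f j)) ->
  denT env (tTab q) f.
Proof.
move=> Hq.
have HN : denP env (tVar 0) (fun v => size v = N) by apply: denP_cap.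
apply: denP_imp (denP_iter (Inv := fun j v => v = [seq f i | i <- iota j (N - j)])
  HN _ _).
- move=> v -> k; rewrite subn0; case: ltnP => h.
    by rewrite (nth_map 0) ?size_iota // nth_iota.
  by rewrite nth_default // size_map size_iota.
- by apply: denP_nil; rewrite subnn.
- move=> env' i acc j pre lt_j Hi Hacc.
  have -> : N - j = (N - j.+1).+1 by lia.
  have Hf : denB env' (q i) (f j) by apply: Hq => //; apply: denN_lt Hi.
  apply: denP_if Hf _ _ => /=.
  + move=> ->; apply: denP_cons; apply: denP_imp Hacc => v ->.
    by rewrite size_map size_iota; case: ifP => //; lia.
  + move=> /negbTE ->; apply: denP_cons; apply: denP_imp Hacc => v ->.
    by rewrite size_map size_iota; case: ifP => //; lia.
Qed.

Lemma denB_odd env a k : k <= N -> denN env a k -> denB env (tOdd a) (odd k).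
Proof.
move=> lek Ha.
have := denP_iter (k := k) (Inv := fun j v => head false v = odd (k - j)) (n := a) (z := tNil).
rewrite subn0; apply.
- by apply: denP_imp Ha => v ->; lia.
- by apply: denP_nil; rewrite subnn.
- move=> env' i acc j pre lt_j Hi Hacc; apply: denB_eq (denB_not Hacc).
  by rewrite -[~~ _]/(odd (k - j.+1).+1) -subSn // subSS.
Qed.

Lemma count_odd_iota k : count odd (iota 0 k) = k./2.
Proof.
elim: k => // k IHk; rewrite -addn1 iotaD count_cat IHk /= add0n addn0 addn1 /=.
by rewrite uphalf_half addnC.
Qed.

Lemma denN_half env a k : k <= N -> denN env a k -> denN env (tHalf a) k./2.
Proof.
move=> lek Ha; rewrite -count_odd_iota; apply: denN_count => // env' i j _ lt_j.
by apply: denB_odd; lia.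
Qed.

Lemma iter_half_le i k : iter i half k <= k.
Proof. by elim: i => //= i IHi; apply: leq_trans IHi; lia. Qed.

Lemma denB_bit env i a l k : l <= N -> k <= N -> denN env i l -> denN env a k ->
  denB env (tBit i a) (bit l k).
Proof.
move=> lel lek Hi Ha; apply: denB_odd; first exact: leq_trans (iter_half_le _ _) lek.
have := denP_iter (k := l) (Inv := fun j v => size v = minn N (iter (l - j) half k)) (n := i) (z := a).
rewrite subn0; apply.
- by apply: denP_imp Hi => v ->; lia.
- by rewrite subnn.
- move=> env' i' acc j pre lt_j Hi' Hacc.
  have -> : l - j = (l - j.+1).+1 by lia.
  by apply: denN_half; first exact: leq_trans (iter_half_le _ _) lek.
Qed.

End Denotation.

(** Length of the initial block of [true], up to [N]: it decodes a number written in unary. *)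
Definition lead (N : nat) (p : nat -> bool) : nat :=
  count (fun k => all p (iota 0 k.+1)) (iota 0 N).

(* Sets of states are numbers, by their bits; labels are numbered from epsilon = 0;
   [K * n + q] is the table entry of the pair [(q, K)]. *)
Section Decision.
Variables (x : seq bool) (N n m : nat).

Definition init_at q := nth false x (n + m + 2 + q).
(** Action [a] has code [a.+1], so the offset is one less than the start of the block. Code 0 reads
    a bit of the preceding block, and [pair_step] tests [e == 0] first. *)
Definition high_at e := nth false x (n + m + n + 1 + e).
Definition ctrl_at e := nth false x (n + m + n + m + 1 + e).
Definition edge_at q e q' :=
  nth false x (n + m + n + m + m + 2 + ((q * m.+1 + e) * n + q')).

Definition post_sub e K K' :=
  all (fun r => all (fun r' => bit r K && edge_at r e r' ==> bit r' K') (iota 0 n))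
    (iota 0 n).

Definition bits_sub K K' := all (fun r => bit r K ==> bit r K') (iota 0 n).

Definition pair_step q K q' K' :=
  has (fun e => edge_at q e q' && (((e == 0) || ~~ ctrl_at e) &&
                if (e == 0) || high_at e then bits_sub K K' else post_sub e K K'))
    (iota 0 m.+1).

(** The epsilon-closedness that [pair_rel] asks of its target is tested here, once for initial pairs
    and steps alike. Initial pairs are added in every round, so the iteration can start from the
    empty table. *)
Definition table_next (R : nat -> bool) idx :=
  has (fun q => has (fun K => (idx == K * n + q) && (post_sub 0 K K &&
        ((init_at q && bit q K) ||
         has (fun q1 => has (fun K1 =>
           ((K1 * n + q1 < N) && R (K1 * n + q1)) && pair_step q1 K1 q K)
           (iota 0 N)) (iota 0 n)))) (iota 0 N)) (iota 0 n).

Definition table t := iter t table_next (fun=> false).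

Definition reaches_empty :=
  has (fun q => has (fun K => ((K * n + q < N) && table N (K * n + q)) &&
                              all (fun i => ~~ bit i K) (iota 0 n)) (iota 0 N)) (iota 0 n).

(** After the leading [true] comes the code of a controller with one memory state: its size
    [true; false], its initial state, its empty output set, and one bit for each of the [m.+1 * n]
    updates. *)
Definition answer_bits : seq bool :=
  if reaches_empty then [:: false]
  else [:: true; true; false; true] ++ nseq m false ++ nseq (m.+1 * n) true.

End Decision.

(** * The decision procedure as a term, and its correctness *)

Definition tLead (p : term -> term) := tCount (tVar 0) (fun k => tAll (tSucc k) p).
Definition tInput i := tNth (tVar 1) i.
Definition tn := tLead tInput.
Definition tm := tLead (fun j => tInput (tAdd (tSucc tn) j)).
Definition tnat k : term := iter k tSucc tNil.
Definition tInit q := tInput (tAdd (tAdd (tAdd tn tm) (tnat 2)) q).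
Definition tHigh e := tInput (tAdd (tAdd (tAdd (tAdd tn tm) tn) (tnat 1)) e).
Definition tCtrl e := tInput (tAdd (tAdd (tAdd (tAdd (tAdd tn tm) tn) tm) (tnat 1)) e).
Definition tEdge q e q' :=
  tInput (tAdd (tAdd (tAdd (tAdd (tAdd (tAdd tn tm) tn) tm) tm) (tnat 2))
               (tAdd (tMul (tAdd (tMul q (tSucc tm)) e) tn) q')).
Definition tPost e K K' :=
  tAll tn (fun r => tAll tn (fun r' => tImp (tAnd (tBit r K) (tEdge r e r')) (tBit r' K'))).
Definition tBits K K' := tAll tn (fun r => tImp (tBit r K) (tBit r K')).
Definition tStep q K q' K' :=
  tEx (tSucc tm) (fun e => tAnd (tEdge q e q') (tAnd (tOr (tIs0 e) (tNot (tCtrl e)))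
    (tIf (tOr (tIs0 e) (tHigh e)) (tBits K K') (tPost e K K')))).
Definition tIdx q K := tAdd (tMul K tn) q.
Definition tNext T idx :=
  tEx tn (fun q => tEx (tVar 0) (fun K => tAnd (tEq idx (tIdx q K)) (tAnd (tPost tNil K K)
    (tOr (tAnd (tInit q) (tBit q K))
         (tEx tn (fun q1 => tEx (tVar 0) (fun K1 =>
            tAnd (tNth T (tIdx q1 K1)) (tStep q1 K1 q K)))))))).
(** The empty list reads as the table that is [false] everywhere. [tReaches] evaluates this term
    anew for each pair, which only affects the degree of the cost. *)
Definition tTable := tIter (tVar 0) tNil (fun _ T => tTab (tNext T)).
Definition tReaches :=
  tEx tn (fun q => tEx (tVar 0) (fun K =>
    tAnd (tNth tTable (tIdx q K)) (tAll tn (fun i => tNot (tBit i K))))).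
Definition tRepeat b k z := tIter k z (fun _ acc => tCons b acc).
Definition tAnswer :=
  tIf tReaches (tCons false tNil)
    (tCons true (tCons true (tCons false (tCons true
      (tRepeat false tm (tRepeat true (tMul (tSucc tm) tn) tNil)))))).

Section DecisionDenotation.
Variables (cap x : seq bool).
Notation N := (size cap).
Hypothesis x_le : size x <= N.
Hypothesis N_gt0 : 0 < N.

Let n := lead N (nth false x).
Let m := lead N (fun j => nth false x (n.+1 + j)).
Hypothesis m_lt : m < N.

Local Notation denN := (denN cap x).
Local Notation denB := (denB cap x).
Local Notation denT := (denT cap x).

Lemma lead_le p : lead N p <= N.
Proof. by rewrite /lead -[X in _ <= X](size_iota 0) count_size. Qed.

Let n_le : n <= N := lead_le _.

Lemma denN_tnat env k : denN env (tnat k) k.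
Proof. by elim: k => [|k IHk]; [apply: denP_nil; rewrite minn0 | apply: denN_succ]. Qed.

Lemma denB_input env i k : denN env i k -> denB env (tInput i) (nth false x k).
Proof.
apply: denB_nth; apply: denP_input.
by case: (leqP N k) => // h; rewrite !nth_default //; apply: leq_trans x_le _.
Qed.

Lemma denN_lead env q p :
  (forall env' i j, prefix env env' -> j < N -> denN env' i j -> denB env' (q i) (p j)) ->
  denN env (tLead q) (lead N p).
Proof.
move=> Hq; apply: denN_count => //; first exact: denN_cap.
move=> env' i j pre lt_j Hi; apply: denB_all => //; first exact: denN_succ.
move=> env2 i2 j2 pre2 lt_j2; apply: Hq; first exact: prefix_trans pre pre2.
by lia.
Qed.

Lemma denN_n env : denN env tn n.
Proof. by apply: denN_lead => *; apply: denB_input. Qed.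

Lemma denN_m env : denN env tm m.
Proof.
apply: denN_lead => *; apply: denB_input; apply: denN_add => //.
by apply: denN_succ => //; apply: denN_n.
Qed.

Ltac den_num := repeat first
  [ assumption | apply: denN_n | apply: denN_m | apply: denN_tnat | apply: denN_cap
  | apply: denN_succ | apply: denN_mul | apply: denN_add ].

Lemma denB_init env a q : denN env a q -> denB env (tInit a) (init_at x n m q).
Proof. by move=> H; apply: denB_input; den_num. Qed.

Lemma denB_high env a q : denN env a q -> denB env (tHigh a) (high_at x n m q).
Proof. by move=> H; apply: denB_input; den_num. Qed.

Lemma denB_ctrl env a q : denN env a q -> denB env (tCtrl a) (ctrl_at x n m q).
Proof. by move=> H; apply: denB_input; den_num. Qed.

Lemma denB_edge env a b c q e q' : denN env a q -> denN env b e -> denN env c q' ->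
  denB env (tEdge a b c) (edge_at x n m q e q').
Proof. by move=> *; apply: denB_input; den_num. Qed.

Lemma denN_idx env a b q K : denN env a q -> denN env b K ->
  denN env (tIdx a b) (K * n + q).
Proof. by move=> *; rewrite /tIdx; den_num. Qed.

(** Going under a binder: all denotations in the context are weakened to the extended
    environment. *)
Ltac enter p :=
  let env' := fresh "env" in let i := fresh "i" in let j := fresh "j" in
  let H := fresh "H" in
  move=> env' i j p ? H;
  repeat match goal with D : _ ?env _ _ |- _ =>
    match type of p with is_true (prefix env env') =>
      apply (denP_mono p) in D end end;
  clear p; lazy beta.

(** Several combinators unfold to [tIf], so the rule is selected by the head symbol. *)
Ltac den_rule :=
  match goal with
  | |- denP _ _ _ _ _ => assumption
  | |- denB _ _ _ => assumption
  | |- denN _ _ _ => assumption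
  | |- denT _ _ _ => assumption
  | |- denB _ ?e _ =>
    lazymatch e with
    | tAnd _ _ => apply: denB_and
    | tOr _ _ => apply: denB_or
    | tImp _ _ => apply: denB_imp
    | tNot _ => apply: denB_not
    | tIf _ _ _ => apply: denB_if
    | tIs0 _ => apply: denB_is0
    | tBit _ _ => apply: denB_bit
    | tInit _ => apply: denB_init
    | tHigh _ => apply: denB_high
    | tCtrl _ => apply: denB_ctrl
    | tEdge _ _ _ => apply: denB_edge
    | tNth _ _ => apply: denB_tab
    | tEx _ _ => apply: denB_ex; [ .. | let p := fresh "p" in enter p]
    | tAll _ _ => apply: denB_all; [ .. | let p := fresh "p" in enter p]
    end
  | |- denN _ ?e _ =>
    lazymatch e with
    | tIdx _ _ => apply: denN_idx
    | tn => apply: denN_n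
    | tm => apply: denN_m
    | tVar 0 => apply: denN_cap
    | tSucc _ => apply: denN_succ
    end
  end.

Ltac den := repeat den_rule; try lia.

Lemma denB_post env a b c e K K' : K <= N -> K' <= N ->
  denN env a e -> denN env b K -> denN env c K' ->
  denB env (tPost a b c) (post_sub x n m e K K').
Proof. by move=> *; rewrite /tPost /post_sub; den. Qed.

Lemma denB_bits env b c K K' : K <= N -> K' <= N ->
  denN env b K -> denN env c K' -> denB env (tBits b c) (bits_sub n K K').
Proof. by move=> *; rewrite /tBits /bits_sub; den. Qed.

Lemma denB_step env a b c d q K q' K' : K <= N -> K' <= N ->
  denN env a q -> denN env b K -> denN env c q' -> denN env d K' ->
  denB env (tStep a b c d) (pair_step x n m q K q' K').
Proof.
move=> *; rewrite /tStep /pair_step; den.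
- by apply: denB_bits.
- by apply: denB_post.
Qed.

Lemma denB_next env T R a idx : idx < N -> denT env T R -> denN env a idx ->
  denB env (tNext T a) (table_next x N n m R idx).
Proof.
move=> *; rewrite /tNext /table_next; den.
- by apply: denB_eqn => //; den.
- by apply: denB_post => //; try lia; apply: denP_nil; rewrite minn0.
- by apply: denB_step => //; lia.
Qed.

Lemma denT_table env : denT env tTable (table x N n m N).
Proof.
have HN : denP cap x env (tVar 0) (fun v => size v = N) by apply: denP_cap.
apply: denP_imp (denP_iter (Inv := fun j v => forall k, nth false v k =
  (k < N) && table x N n m (N - j) k) HN _ _); first by rewrite subn0.
- by apply: denP_nil => k; rewrite subnn nth_nil andbF.
- move=> env' i acc j p lt_j _ Hacc; apply: (denT_tab N_gt0) => env2 i2 j2 p2 lt_j2 H2.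
  have -> : N - j = (N - j.+1).+1 by lia.
  by apply: denB_next => //; apply: denP_mono p2 _.
Qed.

Lemma denB_reaches env : denB env tReaches (reaches_empty x N n m).
Proof. by rewrite /tReaches /reaches_empty; den; apply: denT_table. Qed.

Lemma denP_repeat env b a z k v : k + size v <= N -> denN env a k ->
  denP cap x env z (fun u => u = v) ->
  denP cap x env (tRepeat b a z) (fun u => u = nseq k b ++ v).
Proof.
move=> lek Ha Hz.
have := denP_iter (k := k) (Inv := fun j u => u = nseq (k - j) b ++ v) (n := a) (z := z).
rewrite subn0; apply.
- by apply: denP_imp Ha => u ->; lia.
- by rewrite subnn.
- move=> env' i acc j p lt_j _ Hacc; apply: denP_cons; apply: denP_imp Hacc => u ->.
  rewrite size_cat size_nseq.
  have -> : k - j = (k - j.+1).+1 by lia.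
  by case: ifP => //; lia.
Qed.

(** The left-hand side is the length of a positive answer, so no [Cons] saturates while it is
    written. *)
Lemma eval_answer : 4 + m + m.+1 * n <= N ->
  eval [:: cap; x] (tAnswer 2) = answer_bits x N n m.
Proof.
move=> leN.
suff: denP cap x [::] tAnswer (fun v => v = answer_bits x N n m).
  by apply=> //; apply: prefix_refl.
have Hb := @denB_reaches [::]; rewrite /answer_bits; apply: (denP_if Hb).
  by move=> ->; apply: denP_cons; apply: denP_nil; rewrite N_gt0.
move=> /negbTE ->.
have Hr : denP cap x [::] (tRepeat false tm (tRepeat true (tMul (tSucc tm) tn) tNil))
    (fun v => v = nseq m false ++ nseq (m.+1 * n) true).
  apply: denP_repeat; rewrite ?size_nseq; try lia; first exact: denN_m.
  rewrite -[X in fun u => u = X]cats0; apply: denP_repeat; rewrite ?addn0; try lia.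
  - by den_num.
  - exact: denP_nil.
do 4!apply: denP_cons; apply: denP_imp Hr => v ->.
have sz : size (nseq m false ++ nseq (m.+1 * n) true) = m + m.+1 * n.
  by rewrite size_cat !size_nseq.
have step b (w : seq bool) : size w < N -> (if size w < N then b :: w else w) = b :: w.
  by move=> ->.
rewrite (step true (nseq _ _ ++ _)); last by rewrite sz; lia.
rewrite (step false (true :: _)); last by rewrite /= sz; lia.
rewrite (step true (false :: _)); last by rewrite /= sz; lia.
by rewrite (step true (true :: _)) //= sz; lia.
Qed.

End DecisionDenotation.

(** * Controllers and SNNI *)

Section Simulations.
Variable S : finType.
Implicit Types (Y Z : system S) (L : {set S}).

Definition simulation Y Z (B : sys_state Y -> sys_state Z -> Prop) : Prop :=
  B (sys_init Y) (sys_init Z) /\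
  forall p q e p', B p q -> sys_trans p e p' ->
    exists2 q', sys_trans q e q' & B p' q'.

Lemma simulation_language Y Z B : @simulation Y Z B ->
  forall w, language Y w -> language Z w.
Proof.
case=> B0 Bstep w [r [Hr <-]].
suff H : forall p q, B p q -> run_from p r ->
    exists r', run_from (Y := Z) q r' /\ trace r' = trace r by exact: H B0 Hr.
elim: r {Hr} => [|[e p'] r IHr] p q Bpq /=; first by exists [::].
case=> t Hr; have [q' t' B'] := Bstep _ _ _ _ Bpq t.
have [r' [Hr' e']] := IHr _ _ B' Hr.
by exists ((e, q') :: r'); rewrite /trace /= -/(trace r) -/(trace r') e'.
Qed.

Lemma simulation_hide Y Z B L : @simulation Y Z B -> @simulation (hide Y L) (hide Z L) B.
Proof.
case=> B0 Bstep; split=> // p q e p' Bpq [e' [t ->]].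
by have [q' t' B'] := Bstep _ _ _ _ Bpq t; exists q' => //; exists e'.
Qed.

Lemma simulation_restrict Y Z B L :
  @simulation Y Z B -> @simulation (restrict Y L) (restrict Z L) B.
Proof.
case=> B0 Bstep; split=> // p q e p' Bpq [t nL].
by have [q' t' B'] := Bstep _ _ _ _ Bpq t; exists q'.
Qed.

Lemma SNNI_bisimulation Y Z B L : @simulation Y Z B ->
  @simulation Z Y (fun q p => B p q) -> SNNI Y L -> SNNI Z L.
Proof.
move=> sYZ sZY H w; split=> Hw.
  apply: (simulation_language (simulation_hide L sYZ)); apply/H.
  exact: (simulation_language (simulation_restrict L sZY)).
apply: (simulation_language (simulation_restrict L sYZ)); apply/H.
exact: (simulation_language (simulation_hide L sZY)).
Qed.

Lemma restrict_hide Y L w : language (restrict Y L) w -> language (hide Y L) w.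
Proof.
apply: (@simulation_language (restrict Y L) (hide Y L) eq); split=> // p _ e p' <- [t nL].
by exists p' => //; exists e; rewrite (negbTE nL).
Qed.

End Simulations.

(** * Reduction to the automaton of uncontrollable edges *)

Section EmptyController.
Variables (Q S : finType) (A : automaton Q S) (Sc Sh : {set S}).

Definition no_control (r : seq (option S * Q)) : {set S} := set0.

Definition uncontrolled : automaton Q S :=
  Automaton (aut_init A) [set t in aut_edges A | ~~ label_in Sc t.1.2].

Lemma enabled_no_control e r : enabled Sc e (no_control r) = ~~ label_in Sc e.
Proof. by rewrite /no_control; case: e => //= a; rewrite setI0 in_set0 orbF. Qed.

Lemma enabled_uncontrollable e U : ~~ label_in Sc e -> enabled Sc e U.
Proof. by case: e => //= a ->. Qed.

Lemma uncontrollable_trace r R :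
  @run_from S (hide (controlled A Sc no_control) Sh) r R ->
  all (fun a => a \notin Sc) (trace R).
Proof.
elim: R r => [|[e r'] R IHR] r //= [].
case=> e' [[q' [_ _ He]] -> /IHR HR].
have Hu : ~~ label_in Sc e' by rewrite -(enabled_no_control e' r).
case: e' Hu {He} => [a|] //= Ha; case: ifP => _ //.
by rewrite /trace /= -/(trace R) Ha.
Qed.

(* The letters of an uncontrollable trace stay enabled whatever the controller, so
   a low run witnessing such a trace exists without any controllable action. *)
Lemma no_control_SNNI C :
  SNNI (controlled A Sc C) Sh -> SNNI (controlled A Sc no_control) Sh.
Proof.
move=> HC w; split; first exact: restrict_hide.
move=> Hw.
have Hu : all (fun a => a \notin Sc) w.
  by have [R [HR <-]] := Hw; apply: uncontrollable_trace HR.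
have /HC [R [HR eR]] : language (hide (controlled A Sc C) Sh) w.
  move: Hw; apply: simulation_language; apply: simulation_hide.
  (* Both systems have runs of [A] as states, and what [no_control] enables every controller
     enables: the identity is a simulation. *)
  instantiate (1 := eq); split=> // r _ e r' <- [q' [er Hr He]].
  exists r' => //; exists q'; split=> //; apply: enabled_uncontrollable.
  by rewrite -(enabled_no_control e r).
(* The low run under [C] is itself a run under [no_control]: its labels are epsilon or letters of
   [w], all uncontrollable. *)
exists R; split=> //; move: HR Hu; rewrite -{}eR /is_run /=.
elim: R [::] => [|[e r'] R IHR] r //= [[[q' [er Hr He]] nL] HR].
rewrite /trace /=; case: e er Hr He nL => [a|] er Hr He nL /=.
  case/andP=> Ha Hu; split; last exact: IHR.
  by split=> //; exists q'; split=> //=; rewrite Ha.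
by move=> Hu; split; last exact: IHR; split=> //; exists q'.
Qed.

Lemma run_from_rcons q r e q' :
  @run_from S A q (rcons r (e, q')) <->
  @run_from S A q r /\ (last q (map snd r), e, q') \in aut_edges A.
Proof.
elim: r q => [|[e1 q1] r IHr] q /=; first by split=> [[]|[]].
by rewrite IHr; split=> [[? []]|[[]]].
Qed.

(** When everything controllable is disabled, a run matters only through its last state; this
    relation is a simulation in both directions. *)
Lemma SNNI_uncontrolled :
  SNNI (controlled A Sc no_control) Sh <-> SNNI uncontrolled Sh.
Proof.
pose B (r : seq (option S * Q)) (q : Q) :=
  @is_run S A r /\ last (aut_init A) (map snd r) = q.
have s1 : @simulation S (controlled A Sc no_control) uncontrolled B.
  split=> // r q e r' [Hr eq_q] [q' [-> Hr' He]]; exists q'.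
    move/run_from_rcons: Hr' => [_ E].
    by rewrite /= inE -eq_q E -(enabled_no_control e r).
  by split=> //; rewrite map_rcons last_rcons.
have s2 : @simulation S uncontrolled (controlled A Sc no_control) (fun q r => B r q).
  split=> // q r e q' [Hr eq_q] /=; rewrite inE /= => /andP[E He].
  have Hr' : @is_run S A (rcons r (e, q')) by apply/run_from_rcons; rewrite eq_q.
  exists (rcons r (e, q')); last by split=> //; rewrite map_rcons last_rcons.
  by exists q'; split=> //; rewrite enabled_no_control.
by split; apply: SNNI_bisimulation; eauto.
Qed.

End EmptyController.

(** * SNNI as unreachability of an empty set *)

Section Pairs.
Variables (Q S : finType) (A : automaton Q S) (Sh : {set S}).
Notation E := (aut_edges A).

(** Epsilon is grouped with the high labels, since hiding makes both invisible. *)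
Definition low (e : option S) : bool := if e is Some a then a \notin Sh else false.

Definition post_in (e : option S) (K K' : {set Q}) : bool :=
  [forall r in K, forall r', ((r, e, r') \in E) ==> (r' \in K')].

Lemma post_inP e (K K' : {set Q}) :
  reflect (forall r r', r \in K -> (r, e, r') \in E -> r' \in K') (post_in e K K').
Proof.
apply: (iffP forall_inP) => [H r r' rK rr'|H r rK]; last first.
  by apply/forallP=> r'; apply/implyP; apply: H.
by have /forallP/(_ r')/implyP := H r rK; apply.
Qed.

(* The second component over-approximates the set of states that the low part can
   reach by the same trace; it need not be exact, only closed under epsilon. *)
Definition pair_rel (x y : Q * {set Q}) : bool :=
  [exists e, [&& (x.1, e, y.1) \in E, post_in None y.2 y.2 &
               if low e then post_in e x.2 y.2 else x.2 \subset y.2]].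

Definition leaky : Prop :=
  exists (K : {set Q}) p, [/\ aut_init A \in K, post_in None K K,
    path pair_rel (aut_init A, K) p & (last (aut_init A, K) p).2 = set0].

Definition reads (Y : system S) (q : sys_state Y) (w : seq S) : Prop :=
  exists r, run_from q r /\ trace r = w.

(** The silent moves before the first letter do not leave [K], which is closed. *)
Lemma low_run_split (K : {set Q}) r R a w : post_in None K K -> r \in K ->
  @run_from S (restrict A Sh) r R -> trace R = a :: w ->
  exists r1 r2, [/\ r1 \in K, (r1, Some a, r2) \in E & reads (Y := restrict A Sh) r2 w].
Proof.
move=> /post_inP Kc; elim: R r => [|[[b|] r'] R IHR] r rK //= [[t _] HR].
  by rewrite /trace /= => -[<- ew]; exists r, r'; split=> //; exists R.
exact: (IHR _ (Kc _ _ rK t)).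
Qed.

(** Induction along the path: that no state of the next set reads the rest of the word passes back
    to the current set, because the next one contains its successors, or the set itself after a
    silent step. *)
Lemma path_leak p q (K : {set Q}) : post_in None K K ->
  path pair_rel (q, K) p -> (last (q, K) p).2 = set0 ->
  exists2 w, reads (Y := hide A Sh) q w &
    forall r, r \in K -> ~ reads (Y := restrict A Sh) r w.
Proof.
elim: p q K => [|[q' K'] p IHp] q K Kc /=.
  by move=> _ ->; exists [::]; [exists [::] | move=> r; rewrite inE].
case/andP=> /existsP[e /and3P[/= E1 K'c He]] Hp Hl.
have [w [R [HR ew]] Hw] := IHp _ _ K'c Hp Hl.
case le: (low e) He => He; last first.
  exists w; last by move=> r rK; apply: Hw; apply: (subsetP He).
  exists ((None, q') :: R); split=> //=; split=> //; exists e; split=> //.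
  by case: e le {E1} => //= a /negbFE ->.
case: e le E1 He => // a la E1 /post_inP He; exists (a :: w).
  exists ((Some a, q') :: R); rewrite /trace /= -/(trace R) ew; split=> //; split=> //.
  by exists (Some a); rewrite /= (negbTE la).
move=> r rK [R' [HR' eR']].
have [r1 [r2 [r1K E2 Hr2]]] := low_run_split Kc rK HR' eR'.
exact: Hw (He _ _ r1K E2) Hr2.
Qed.

Definition eps_rel : rel Q := fun r r' => (r, None, r') \in E.

Definition eps_closure (K : {set Q}) : {set Q} :=
  [set r | [exists p in K, connect eps_rel p r]].

Lemma eps_closureP (K : {set Q}) r :
  reflect (exists2 p, p \in K & connect eps_rel p r) (r \in eps_closure K).
Proof. by rewrite inE; apply: exists_inP. Qed.

Lemma eps_closure_closed K : post_in None (eps_closure K) (eps_closure K).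
Proof.
apply/post_inP=> r r' /eps_closureP[p pK pr] rr'; apply/eps_closureP; exists p => //.
by apply: connect_trans pr (connect1 _).
Qed.

Lemma eps_reads p r w : connect eps_rel p r ->
  reads (Y := restrict A Sh) r w -> reads (Y := restrict A Sh) p w.
Proof.
case/connectP=> s Hs ->; elim: s p Hs => //= q s IHs p /andP[pq Hs] /IHs[//|R [HR ew]].
by exists ((None, q) :: R).
Qed.

(** Follow the run with the exact closed successor sets. If the final set has an element, tracing it
    back yields a low run with the same trace; otherwise the sets visited form the path. *)
Lemma run_leak R q (K : {set Q}) : post_in None K K -> @run_from S (hide A Sh) q R ->
  (exists2 r, r \in K & reads (Y := restrict A Sh) r (trace R)) \/
  (exists2 p, path pair_rel (q, K) p & (last (q, K) p).2 = set0).
Proof.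
elim: R q K => [|[e q'] R IHR] q K Kc /=.
  case: (set_0Vmem K) => [->|[r rK]] _; first by right; exists [::].
  by left; exists r => //; exists [::].
case=> -[e' [E1 ->]] HR.
case le: (low e'); last first.
  have -> : (if label_in Sh e' then None else e') = None.
    by case: e' le {E1} => //= a /negbFE ->.
  (* An epsilon or high step leaves the set as it is. *)
  case: (IHR _ _ Kc HR) => [H|[p Hp Hl]]; [by left | right].
  exists ((q', K) :: p) => //=; rewrite Hp andbT; apply/existsP; exists e'.
  by rewrite /= E1 Kc le /=.
case: e' le E1 => // a la E1; rewrite /= (negbTE la) /trace /= -/(trace R).
pose K' := eps_closure [set r' | [exists r in K, (r, Some a, r') \in E]].
case: (IHR _ K' (eps_closure_closed _) HR) => [[r rK' Hr]|[p Hp Hl]]; [left | right].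
  have [p] := eps_closureP _ _ rK'; rewrite inE => /exists_inP[r0 r0K E2] pr.
  have [R' [HR' eR']] := eps_reads pr Hr.
  exists r0 => //; exists ((Some a, p) :: R').
  by rewrite /trace /= -/(trace R') eR'; split.
exists ((q', K') :: p) => //=; rewrite Hp andbT; apply/existsP; exists (Some a).
have {}la : a \notin Sh := la.
rewrite /= E1 eps_closure_closed la /=; apply/post_inP=> r r' rK rr'.
apply/eps_closureP; exists r' => //; rewrite inE; apply/exists_inP; by exists r.
Qed.

Lemma leaky_SNNI : leaky -> ~ SNNI A Sh.
Proof.
move=> [K [p [K0 Kc Hp Hl]]] H; have [w Hw nw] := path_leak Kc Hp Hl.
by apply: (nw _ K0); apply/H.
Qed.

Lemma not_leaky_SNNI : ~ leaky -> SNNI A Sh.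
Proof.
move=> H w; split; first exact: restrict_hide.
case=> R [HR <-]; pose K := eps_closure [set aut_init A].
have [[r rK Hr]|[p Hp Hl]] := run_leak (eps_closure_closed [set aut_init A]) HR.
  by have [p] := eps_closureP _ _ rK; rewrite inE => /eqP -> pr; apply: eps_reads pr Hr.
case: H; exists K, p; split=> //; last exact: eps_closure_closed.
by apply/eps_closureP; exists (aut_init A); rewrite ?inE.
Qed.

End Pairs.

(** * The reachability table and the encoding *)

Lemma has_iotaP n (p : pred nat) :
  reflect (exists2 k, k < n & p k) (has p (iota 0 n)).
Proof.
by apply: (iffP hasP) => -[k]; rewrite ?mem_iota => Hk Hp; exists k;
  rewrite ?mem_iota.
Qed.

Lemma has_iota_ordP n (p : pred nat) :
  reflect (exists k : 'I_n, p k) (has p (iota 0 n)).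
Proof.
apply: (iffP (has_iotaP _ _)) => [[k lt_k pk]|[k pk]]; last by exists k.
by exists (Ordinal lt_k).
Qed.

Lemma all_iota_ordP n (p : pred nat) :
  reflect (forall k : 'I_n, p k) (all p (iota 0 n)).
Proof.
apply: (iffP allP) => H k; first by apply: H; rewrite mem_iota ltn_ord.
by rewrite mem_iota => /= lt_k; apply: (H (Ordinal lt_k)).
Qed.

Lemma exists_bits n (p : pred nat) :
  exists2 K, K < 2 ^ n & forall i, i < n -> bit i K = p i.
Proof.
elim: n p => [|n IHn] p; first by exists 0.
have [K ltK HK] := IHn (fun i => p i.+1).
exists (p 0 + K.*2); first by rewrite expnS; case: (p 0); lia.
case=> [_|i lti]; rewrite /bit ?iterSr.
  by rewrite /= oddD odd_double addbF oddb.
by rewrite half_bit_double -[odd _]/(bit i K) HK.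
Qed.

Definition label_code m (e : option 'I_m) : nat := if e is Some a then a.+1 else 0.

Lemma has_label_codeP m (p : pred nat) :
  reflect (exists e : option 'I_m, p (label_code e)) (has p (iota 0 m.+1)).
Proof.
apply: (iffP (has_iotaP _ _)) => [[[|k] lt_k pk]|[[a|] pe]].
- by exists None.
- by exists (Some (Ordinal (lt_k : k < m))).
- by exists a.+1; first exact: (ltn_ord a).
- by exists 0.
Qed.

Section Table.
Variables (n m : nat) (A : automaton 'I_n 'I_m) (Sh Sc : {set 'I_m}).
Variables (x : seq bool) (N : nat).
Hypothesis N_large : 2 ^ n * n <= N.
Hypothesis initE : forall q : 'I_n, init_at x n m q = (q == aut_init A).
Hypothesis highE : forall a : 'I_m, high_at x n m a.+1 = (a \in Sh).
Hypothesis ctrlE : forall a : 'I_m, ctrl_at x n m a.+1 = (a \in Sc).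
Hypothesis edgeE : forall (q q' : 'I_n) e,
  edge_at x n m q (label_code e) q' = ((q, e, q') \in aut_edges A).

Notation Au := (uncontrolled A Sc).
Notation prel := (pair_rel Au Sh).
Notation q0 := (aut_init A).

Definition bits_set (K : nat) : {set 'I_n} := [set i : 'I_n | bit i K].

Lemma bits_set_onto X : exists2 K, K < 2 ^ n & bits_set K = X.
Proof.
have [K ltK HK] := exists_bits n [pred i | [exists j : 'I_n, (j == i :> nat) && (j \in X)]].
exists K => //; apply/setP=> i; rewrite inE HK //=.
apply/existsP/idP => [[j /andP[/eqP/val_inj ->]] //|iX].
by exists i; rewrite eqxx.
Qed.

Lemma post_subE e K K' : ~~ label_in Sc e ->
  post_sub x n m (label_code e) K K' = post_in Au e (bits_set K) (bits_set K').
Proof.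
move=> Hu; apply/all_iota_ordP/post_inP => H r.
  move=> r'; rewrite !inE /= => rK /andP[rr' _].
  by have /all_iota_ordP/(_ r')/implyP := H r; rewrite rK edgeE; apply.
apply/all_iota_ordP=> r'; apply/implyP=> /andP[rK]; rewrite edgeE => rr'.
by have := H r r'; rewrite !inE /= rr' Hu; apply.
Qed.

Lemma bits_subE K K' : bits_sub n K K' = (bits_set K \subset bits_set K').
Proof.
apply/all_iota_ordP/subsetP => H r; first by rewrite !inE; apply/implyP.
by apply/implyP; have := H r; rewrite !inE.
Qed.

Lemma pair_stepE (q q' : 'I_n) K K' : post_sub x n m 0 K' K' ->
  pair_step x n m q K q' K' = prel (q, bits_set K) (q', bits_set K').
Proof.
rewrite (post_subE (e := None)) // => K'c.
apply/has_label_codeP/existsP => -[e He]; exists e; move: He; rewrite edgeE /= inE /= K'c /=.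
  case: e => [a|] /=; rewrite ?ctrlE ?highE ?bits_subE.
    case/and3P=> -> Ha /=; rewrite Ha /=.
    by case: (a \in Sh) => //=; rewrite -(post_subE (e := Some a)).
  by case/andP=> ->.
case: e => [a|] /=; rewrite ?ctrlE ?highE ?bits_subE.
  case/andP=> /andP[-> Ha] /=; rewrite Ha /=.
  by case: (a \in Sh) => //=; rewrite -(post_subE (e := Some a)).
by case/andP=> /andP[->].
Qed.

Lemma pair_index_inj (q q' : 'I_n) K K' :
  K * n + q = K' * n + q' -> K = K' /\ q = q'.
Proof.
move=> e; have n0 : 0 < n by apply: leq_ltn_trans (ltn_ord q).
have := congr1 (divn^~ n) e; rewrite !divnMDl // !divn_small // !addn0 => eK.
by split=> //; apply: val_inj; move: e; rewrite eK => /addnI.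
Qed.

Definition pair_reach (y : 'I_n * {set 'I_n}) : Prop :=
  exists (K0 : {set 'I_n}) p, [/\ q0 \in K0, post_in Au None K0 K0,
    path prel (q0, K0) p & last (q0, K0) p = y].

(** [K] may exceed [2 ^ n] here, which is harmless because [bits_set] ignores the bits from [n] on.
    Injectivity of the indexing identifies the pair stored at an index. *)
Lemma table_sound t idx : table x N n m t idx ->
  exists (q : 'I_n) K, idx = K * n + q /\ pair_reach (q, bits_set K).
Proof.
elim: t idx => // t IHt idx /has_iota_ordP[q /has_iotaP[K _]].
case/and3P=> /eqP -> Kc Hq; exists q, K; split=> //.
case/orP: Hq => [/andP[]|/has_iota_ordP[q1 /has_iotaP[K1 _ /andP[/andP[_ H1] H2]]]].
  rewrite initE => /eqP -> qK; exists (bits_set K), [::]; split=> //.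
    by rewrite inE.
  by rewrite -(post_subE (e := None)).
have [q2 [K2 [/pair_index_inj[<- <-]]]] := IHt _ H1.
move=> [K0 [p [q0K0 K0c Hp Hl]]].
exists K0, (rcons p (q, bits_set K)); split=> //; last by rewrite last_rcons.
by rewrite rcons_path Hp Hl -pair_stepE.
Qed.

(** Induction on the rounds, removing the last vertex of the path. Every set has a code below
    [2 ^ n], and for such codes the index lies below [N]. *)
Lemma table_complete t (K0 : {set 'I_n}) p K q :
  q0 \in K0 -> post_in Au None K0 K0 -> path prel (q0, K0) p -> size p < t ->
  last (q0, K0) p = (q, bits_set K) -> K < 2 ^ n -> table x N n m t (K * n + q).
Proof.
move=> q0K0 K0c; elim: t p K q => // t IHt p K q Hp lt_p Hl ltK.
have lt_N K1 (q1 : 'I_n) : K1 < 2 ^ n -> K1 * n + q1 < N /\ K1 < N.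
  move=> lt1; have := ltn_ord q1; nia.
apply/has_iota_ordP; exists q; apply/has_iotaP; exists K; first by case: (lt_N K q ltK).
rewrite eqxx /=.
case/lastP: p Hp lt_p Hl => [|p [q' X]].
  move=> _ _ [<- eK0]; rewrite (post_subE (e := None)) // -eK0 K0c initE eqxx /=.
  by move: q0K0; rewrite eK0 inE => ->.
rewrite rcons_path last_rcons size_rcons => /andP[Hp Hr] lt_p [eq' eX].
rewrite {}eq' {}eX in Hr.
case Hl: (last _ p) Hr => [q1 X1] Hr.
have [K1 ltK1 eK1] := bits_set_onto X1.
have Kc : post_sub x n m 0 K K.
  by rewrite (post_subE (e := None)) //; case/existsP: Hr => e /and3P[].
rewrite Kc /=; apply/orP; right.
apply/has_iota_ordP; exists q1; apply/has_iotaP; exists K1; first by case: (lt_N K1 q1 ltK1).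
rewrite (lt_N K1 q1 ltK1).1 /= (pair_stepE _ _ _ Kc) eK1 Hr andbT.
by apply: IHt Hp _ _ ltK1; rewrite ?eK1.
Qed.

Lemma reaches_emptyP : reflect (leaky Au Sh) (reaches_empty x N n m).
Proof.
apply: (iffP idP).
  case/has_iota_ordP=> q /has_iotaP[K _ /andP[/andP[_ HT] /all_iota_ordP HK]].
  have [q1 [K1 [/pair_index_inj[<- <-]]]] := table_sound HT.
  move=> [K0 [p [q0K0 K0c Hp Hl]]]; exists K0, p; split=> //; rewrite Hl /=.
  by apply/setP=> i; rewrite !inE; apply: negbTE.
move=> [K0 [p [q0K0 K0c Hp Hl]]].
(* A path without repetition visits at most [n * 2 ^ n] pairs, so [N] rounds find its end. *)
case/shortenP: Hp Hl => p' Hp' Up' _ Hl.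
case El: (last _ p') Hl => [q X] /= eX; subst X.
have [K ltK eK] := bits_set_onto set0.
have lt_N : K * n + q < N /\ K < N by have := ltn_ord q; nia.
apply/has_iota_ordP; exists q; apply/has_iotaP; exists K; first by case: lt_N.
rewrite lt_N.1 /=; apply/andP; split.
  apply: (table_complete (K0 := K0) (p := p')) => //; last by rewrite eK.
  have := card_uniqP Up'; have := max_card (mem ((q0, K0) :: p')).
  rewrite card_prod card_ord -cardsT -powersetT card_powerset cardsT card_ord /= => h1 h2.
  by apply: leq_trans N_large; rewrite mulnC; move: h1; rewrite h2.
by apply/all_iota_ordP=> i; have := in_set0 i; rewrite -eK inE => ->.
Qed.

End Table.

(** * Reading an instance back from its encoding *)

Lemma lead_eq N k (p : nat -> bool) : k <= N ->
  (forall j, j < k -> p j) -> ~~ p k -> lead N p = k.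
Proof.
move=> lek Hp Hk; rewrite /lead.
have -> : iota 0 N = iota 0 k ++ iota k (N - k) by rewrite -iotaD subnKC.
rewrite count_cat (eq_in_count (a2 := predT)) ?count_predT ?size_iota; last first.
  move=> i; rewrite mem_iota add0n => lt_i; apply: (introT allP) => j.
  by rewrite mem_iota => lt_j; apply: Hp; lia.
rewrite (eq_in_count (a2 := pred0)) ?count_pred0 ?addn0 // => i.
rewrite mem_iota => /andP[le_i _]; apply/negbTE/negP => /allP/(_ k).
by rewrite mem_iota (negbTE Hk) => H; have := H ltac:(lia).
Qed.

Lemma nth_enc_nat n r j : j <= n -> nth false (enc_nat n ++ r) j = (j < n).
Proof.
move=> lej; rewrite nth_cat size_rcons size_nseq ltnS lej nth_rcons size_nseq.
by case: ltnP => h; rewrite ?nth_nseq ?h //; case: eqP.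
Qed.

Lemma nth_enc_natS n r j : nth false (enc_nat n ++ r) (n.+1 + j) = nth false r j.
Proof. by rewrite nth_cat size_rcons size_nseq ltnNge leq_addr addKn. Qed.

Lemma size_enc_nat n : size (enc_nat n) = n.+1.
Proof. by rewrite size_rcons size_nseq. Qed.

Lemma size_enc_set (T : finType) (B : {set T}) : size (enc_set B) = #|T|.
Proof. by rewrite size_map -cardT. Qed.

Lemma nth_enc_set_cat (T : finType) (B : {set T}) r k :
  nth false (enc_set B ++ r) (#|T| + k) = nth false r k.
Proof. by rewrite nth_cat size_enc_set ltnNge leq_addr addKn. Qed.

Lemma nth_enc_set_ord n (B : {set 'I_n}) r (i : 'I_n) :
  nth false (enc_set B ++ r) i = (i \in B).
Proof.
rewrite nth_cat size_enc_set card_ord ltn_ord (nth_map i) ?size_enum_ord //.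
by rewrite nth_ord_enum.
Qed.

Lemma nth_allpairs (T1 T2 T : Type) (f : T1 -> T2 -> T) x1 x2 x0 s t i j :
  i < size s -> j < size t ->
  nth x0 [seq f x y | x <- s, y <- t] (i * size t + j) = f (nth x1 s i) (nth x2 t j).
Proof.
elim: s i => [|a s IHs] [|i] //= lti ltj; rewrite nth_cat size_map.
  by rewrite ltj (nth_map x2).
by rewrite mulSn -addnA ltnNge leq_addr addKn IHs.
Qed.

Lemma enum_prodE (T1 T2 : finType) :
  enum {: T1 * T2} = [seq (a, b) | a <- enum T1, b <- enum T2].
Proof. by rewrite [LHS]enumT [in LHS]unlock. Qed.

Lemma enum_optionE (T : finType) : enum {: option T} = None :: map some (enum T).
Proof. by rewrite [LHS]enumT [in LHS]unlock /= /option_enum -enumT. Qed.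

(** Products are enumerated row by row and options with [None] first, which is the origin of the
    index arithmetic of [edge_at] and of the code 0 for epsilon. *)
Lemma nth_enc_edges n m (B : {set 'I_n * option 'I_m * 'I_n}) (q q' : 'I_n) e :
  nth false (enc_set B) ((q * m.+1 + label_code e) * n + q') = ((q, e, q') \in B).
Proof.
have so : size (enum {: option 'I_m}) = m.+1.
  by rewrite enum_optionE /= size_map size_enum_ord.
have se : label_code e < m.+1 by case: e => //= a; rewrite ltnS.
have ne : nth None (enum {: option 'I_m}) (label_code e) = e.
  rewrite enum_optionE; case: e {se} => //= a.
  by rewrite (nth_map a) ?size_enum_ord // nth_ord_enum.
have H1 : nth (q, e) (enum {: 'I_n * option 'I_m}) (q * m.+1 + label_code e) = (q, e).
  by rewrite enum_prodE -so (nth_allpairs _ q None) ?size_enum_ord ?so // nth_ord_enum ne.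
have s1 : q * m.+1 + label_code e < size (enum {: 'I_n * option 'I_m}).
  rewrite -cardT card_prod card_option !card_ord.
  by have := ltn_ord q; nia.
have H2 : nth (q, e, q') (enum {: 'I_n * option 'I_m * 'I_n})
            ((q * m.+1 + label_code e) * n + q') = (q, e, q').
  rewrite enum_prodE -[X in _ * X + _](size_enum_ord n).
  by rewrite (nth_allpairs _ (q, e) q') ?size_enum_ord // nth_ord_enum H1.
rewrite /enc_set (nth_map (q, e, q')) ?H2 //.
rewrite -cardT card_prod card_ord; move: s1; rewrite -cardT.
by have := ltn_ord q'; nia.
Qed.

Section Encoding.
Variable I : instance.
Notation n := (inst_nstates I).
Notation m := (inst_nactions I).
Notation x := (enc_instance I).
Notation N := (2 ^ size x).

Lemma size_enc_instance : size x = n + m + 2 + n + m + m + n * m.+1 * n.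
Proof.
rewrite /enc_instance !size_cat !size_enc_nat !size_enc_set.
by rewrite !card_prod card_option !card_ord; lia.
Qed.

Lemma nstates_gt0 : 0 < n.
Proof. exact: leq_ltn_trans (ltn_ord (aut_init (inst_aut I))). Qed.

Lemma size_lt_N : size x < N.
Proof. exact: ltn_expl. Qed.

Lemma lead_n : lead N (nth false x) = n.
Proof.
have lt_N := size_lt_N; have sz := size_enc_instance.
apply: lead_eq; first by rewrite (leq_trans _ (ltnW lt_N)) // sz; lia.
  by move=> j lt_j; rewrite nth_enc_nat // ltnW.
by rewrite nth_enc_nat // ltnn.
Qed.

Lemma lead_m : lead N (fun j => nth false x (n.+1 + j)) = m.
Proof.
have lt_N := size_lt_N; have sz := size_enc_instance.
apply: lead_eq; first by rewrite (leq_trans _ (ltnW lt_N)) // sz; lia.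
  by move=> j lt_j; rewrite nth_enc_natS nth_enc_nat // ltnW.
by rewrite nth_enc_natS nth_enc_nat // ltnn.
Qed.

Lemma init_atE (q : 'I_n) : init_at x n m q = (q == aut_init (inst_aut I)).
Proof.
rewrite /init_at (_ : n + m + 2 + q = n.+1 + (m.+1 + q)); last lia.
by rewrite !nth_enc_natS nth_enc_set_ord inE.
Qed.

Lemma high_atE (a : 'I_m) : high_at x n m a.+1 = (a \in inst_high I).
Proof.
rewrite /high_at (_ : n + m + n + 1 + a.+1 = n.+1 + (m.+1 + (#|'I_n| + a))); last first.
  by rewrite card_ord; lia.
by rewrite !nth_enc_natS nth_enc_set_cat nth_enc_set_ord.
Qed.

Lemma ctrl_atE (a : 'I_m) : ctrl_at x n m a.+1 = (a \in inst_ctrl I).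
Proof.
rewrite /ctrl_at.
rewrite (_ : n + m + n + m + 1 + a.+1 = n.+1 + (m.+1 + (#|'I_n| + (#|'I_m| + a)))); last first.
  by rewrite !card_ord; lia.
by rewrite !nth_enc_natS !nth_enc_set_cat nth_enc_set_ord.
Qed.

Lemma edge_atE (q q' : 'I_n) e :
  edge_at x n m q (label_code e) q' = ((q, e, q') \in aut_edges (inst_aut I)).
Proof.
rewrite /edge_at; set j := _ + q'.
rewrite (_ : n + m + n + m + m + 2 + j =
   n.+1 + (m.+1 + (#|'I_n| + (#|'I_m| + (#|'I_m| + j))))); last by rewrite !card_ord; lia.
by rewrite !nth_enc_natS !nth_enc_set_cat nth_enc_edges.
Qed.

(** The input has at least [2 * n] bits: the unary [n] and the block of the initial state. *)
Lemma N_large : 2 ^ n * n <= N.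
Proof.
have h1 : 2 ^ n * n <= 2 ^ (n + n).
  by rewrite expnD leq_mul2l ltnW ?orbT // ltn_expl.
have h2 : n + n <= size x by rewrite size_enc_instance; lia.
by rewrite (leq_trans h1) // leq_exp2l.
Qed.

Lemma eval_tAnswer :
  eval [:: nseq N true; x] (tAnswer 2) = answer_bits x N n m.
Proof.
have lt_N := size_lt_N; have n0 := nstates_gt0.
have sz := size_enc_instance.
have hN : size (nseq N true) = N by rewrite size_nseq.
(* As [n > 0], the edge block alone has at least [m.+1 * n] bits, so the input is long enough for
   the answer to fit under the cap. *)
have h1 : n + m + 2 + n + m + m + m.+1 * n <= size x by rewrite sz; nia.
have := @eval_answer (nseq N true) x; rewrite hN lead_n lead_m; apply; lia.
Qed.

Definition trivial_fsc : fsc 'I_n 'I_m :=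
  @FSC 'I_n 'I_m 1 ord0 (fun _ _ => ord0) (fun=> set0).

Lemma enc_trivial_fsc :
  enc_fsc trivial_fsc = [:: true; false; true] ++ nseq m false ++ nseq (m.+1 * n) true.
Proof.
have map_const (T : Type) (s : seq T) (b : bool) (f : T -> bool) :
    (forall a, f a = b) -> map f s = nseq (size s) b.
  by move=> Hf; elim: s => //= a s ->; rewrite Hf.
have e1 : enum 'I_1 = [:: ord0] by rewrite enum_ordSl enum_ord0.
have s1 : enc_set [set ord0 : 'I_1] = [:: true] by rewrite /enc_set e1 /= inE.
rewrite /enc_fsc /= s1 e1 /= !cats0.
have -> : enc_set (set0 : {set 'I_m}) = nseq m false.
  by rewrite /enc_set (map_const _ _ false) ?size_enum_ord // => a; rewrite inE.
have flatten_const (T : Type) (s : seq T) : flatten [seq [:: true] | _ <- s] = nseq (size s) true.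
  by elim: s => //= a s ->.
by rewrite flatten_const -cardT card_prod card_option !card_ord.
Qed.

End Encoding.

Theorem theorem8 :
  solvable_in_EXPTIME enc_instance
    (fun I : instance => ~ deterministic (restrict (inst_aut I) (inst_high I)))
    SNNI_CSP_answer.
Proof.
have [M [p Mp]] := eval_in_EXPTIME (tAnswer 2); exists M, p => I _.
exists (answer_bits (enc_instance I) (2 ^ size (enc_instance I)) (inst_nstates I) (inst_nactions I)).
split; first by rewrite -eval_tAnswer.
have := reaches_emptyP (@N_large I) (@init_atE I) (@high_atE I) (@ctrl_atE I) (@edge_atE I).
rewrite /answer_bits; case=> H; [left | right].
  split=> // -[C [_ /no_control_SNNI/SNNI_uncontrolled]].
  exact: leaky_SNNI.
exists (trivial_fsc I); split; first by rewrite enc_trivial_fsc.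
split; first by move=> r _; apply: sub0set.
(* The controller read off [trivial_fsc] is convertible to [no_control]. *)
by apply/SNNI_uncontrolled; apply: not_leaky_SNNI.
Qed.
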